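(* Assume that $1-\frac{\alpha R_1}{\mu}\ge0$ and that the steady density profile $\overline\rho=\overline\rho(r)\in C^\infty([R_1,R_2])$, $\overline\rho>0$, satisfies $D\overline\rho(r_s)>0$ for some $r_s\in(R_1,R_2)$. Then the steady state $(\mathbf 0,\overline\rho)$ is linearly unstable. Namely, there exist a nonzero initial value $(\widetilde{\mathbf{V}}_0,\widetilde\rho_0)=((\widetilde v_{0r},\widetilde v_{0\theta}),\widetilde\rho_0)$ and a constant $\lambda>0$ such that $$(\widetilde{\mathbf{V}},\widetilde\rho)=e^{\lambda t}(\widetilde{\mathbf{V}}_0,\widetilde\rho_0)$$ is the solution, with initial value $(\widetilde{\mathbf{V}}_0,\widetilde\rho_0)$, to the linearized system $$\begin{cases}\overline\rho\,\partial_t\widetilde v_r=\mu\left(\Delta_r\widetilde v_r-\frac{\widetilde v_r}{r^2}-\frac2{r^2}\partial_\theta\widetilde v_\theta\right)-\partial_r\widetilde p-\widetilde\rho g,\\ \overline\rho\,\partial_t\widetilde v_\theta=\mu\left(\Delta_r\widetilde v_\theta-\frac{\widetilde v_\theta}{r^2}+\frac2{r^2}\partial_\theta\widetilde v_r\right)-\frac1r\partial_\theta\widetilde p,\\ \partial_t\widetilde\rho=-\widetilde v_rD\overline\rho,\quad \partial_r(r\widetilde v_r)+\partial_\theta\widetilde v_\theta=0,\end{cases}$$ (for some pressure $\widetilde p$), with boundary conditions $\widetilde v_r|_{r=R_1,R_2}=\widetilde v_\theta|_{r=R_2}=0$ and $\partial_r\widetilde v_\theta=\left(\frac1r-\frac\alpha\mu\right)\widetilde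 v_\theta$ at $r=R_1$.
   Context: $0<R_1<R_2$, $\mu>0$, $g>0$ and $\alpha$ are constants; $D=\frac{d}{dr}$. The domain is $\widetilde\Omega=\{(r,\theta):R_1\le r\le R_2,\ 0\le\theta\le2\pi\}$ and all functions are $2\pi$-periodic in $\theta$. $\Delta_r=\partial_{rr}+\frac1r\partial_r+\frac1{r^2}\partial_{\theta\theta}$. The steady state consists of zero velocity, density $\overline\rho(r)$ and pressure $\overline p(r)$ with $D\overline p=-\overline\rho g$. *)

(* Defs.v *)
From Stdlib Require Import Reals.
From Coquelicot Require Import Coquelicot.

Open Scope R_scope.

(** Derivatives relative to a set [S]: [is_derive] with [locally x] replaced by
    its trace on [S].  On a closed interval this is the usual derivative inside
    and the one-sided derivative at the end points, so that only the values of
    the function on [S] matter.  As for [RInt], the total operator is [iota] of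
    the relational one; it is meaningful where [S] has no isolated point. *)

Definition is_derive_on (S : R -> Prop) (f : R -> R) (x l : R) : Prop :=
  filterdiff f (within S (locally x)) (fun h : R => scal h l).

Definition ex_derive_on (S : R -> Prop) (f : R -> R) (x : R) : Prop :=
  exists l : R, is_derive_on S f x l.

Definition derive_on (S : R -> Prop) (f : R -> R) (x : R) : R :=
  iota (T := R_CompleteNormedModule) (is_derive_on S f x).

Fixpoint derive_on_n (S : R -> Prop) (f : R -> R) (n : nat) (x : R) : R :=
  match n with
  | O => f x
  | Datatypes.S m => derive_on S (derive_on_n S f m) x
  end.

Definition smooth_on (S : R -> Prop) (f : R -> R) : Prop :=
  forall (n : nat) (x : R), S x -> ex_derive_on S (derive_on_n S f n) x.

Definition Icc (a b : R) : R -> Prop := fun x => a <= x <= b.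
Definition nonneg_time : R -> Prop := fun t => 0 <= t.

(** A field is written [f t r th] with [t >= 0], [R1 <= r <= R2] and [th] any
    real number, the dependence on [th] being 2*PI-periodic. *)

Definition field : Type := R -> R -> R -> R.

Definition dt (f : field) : field :=
  fun t r th => derive_on nonneg_time (fun s => f s r th) t.

Definition dr (R1 R2 : R) (f : field) : field :=
  fun t r th => derive_on (Icc R1 R2) (fun x => f t x th) r.

Definition dth (f : field) : field :=
  fun t r th => Derive (fun x => f t r x) th.

Definition laplace_r (R1 R2 : R) (f : field) : field :=
  fun t r th =>
    dr R1 R2 (dr R1 R2 f) t r th + 1 / r * dr R1 R2 f t r th
    + 1 / r ^ 2 * dth (dth f) t r th.

Definition continuous_field (R1 R2 : R) (f : field) : Prop :=
  continuous_on
    (fun q : R * R * R => nonneg_time (fst (fst q)) /\ Icc R1 R2 (snd (fst q)))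
    (fun q : R * R * R => f (fst (fst q)) (snd (fst q)) (snd q)).

Definition C1_time (R1 R2 : R) (f : field) : Prop :=
  (forall t r th, 0 <= t -> R1 <= r <= R2 ->
     ex_derive_on nonneg_time (fun s => f s r th) t)
  /\ continuous_field R1 R2 f
  /\ continuous_field R1 R2 (dt f).

Definition C1_space (R1 R2 : R) (f : field) : Prop :=
  (forall t r th, 0 <= t -> R1 <= r <= R2 ->
     ex_derive_on (Icc R1 R2) (fun x => f t x th) r
     /\ ex_derive (fun x => f t r x) th)
  /\ continuous_field R1 R2 f
  /\ continuous_field R1 R2 (dr R1 R2 f)
  /\ continuous_field R1 R2 (dth f).

Definition C2_space (R1 R2 : R) (f : field) : Prop :=
  C1_space R1 R2 f /\ C1_space R1 R2 (dr R1 R2 f) /\ C1_space R1 R2 (dth f).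

Definition periodic_field (R1 R2 : R) (f : field) : Prop :=
  forall t r th, 0 <= t -> R1 <= r <= R2 -> f t r (th + 2 * PI) = f t r th.

Definition steady_state (R1 R2 g : R) (rhobar pbar : R -> R) : Prop :=
  forall r, R1 <= r <= R2 ->
    is_derive_on (Icc R1 R2) pbar r (- rhobar r * g).

(** Classical solutions: every derivative occurring in the system exists and is
    continuous up to [t = 0] and up to the boundary circles. *)

Record linearized_solution (R1 R2 mu g alpha : R) (rhobar : R -> R)
    (vr vth rho p : field) : Prop := {
  vr_periodic : periodic_field R1 R2 vr;
  vth_periodic : periodic_field R1 R2 vth;
  rho_periodic : periodic_field R1 R2 rho;
  p_periodic : periodic_field R1 R2 p;

  vr_regular : C1_time R1 R2 vr /\ C2_space R1 R2 vr;
  vth_regular : C1_time R1 R2 vth /\ C2_space R1 R2 vth;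
  rho_regular : C1_time R1 R2 rho;
  p_regular : C1_space R1 R2 p;

  momentum_r : forall t r th, 0 <= t -> R1 <= r <= R2 ->
    rhobar r * dt vr t r th
    = mu * (laplace_r R1 R2 vr t r th - vr t r th / r ^ 2
            - 2 / r ^ 2 * dth vth t r th)
      - dr R1 R2 p t r th - rho t r th * g;
  momentum_th : forall t r th, 0 <= t -> R1 <= r <= R2 ->
    rhobar r * dt vth t r th
    = mu * (laplace_r R1 R2 vth t r th - vth t r th / r ^ 2
            + 2 / r ^ 2 * dth vr t r th)
      - 1 / r * dth p t r th;
  mass : forall t r th, 0 <= t -> R1 <= r <= R2 ->
    dt rho t r th = - vr t r th * derive_on (Icc R1 R2) rhobar r;
  incompressible : forall t r th, 0 <= t -> R1 <= r <= R2 ->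
    dr R1 R2 (fun t r th => r * vr t r th) t r th + dth vth t r th = 0;

  vr_inner : forall t th, 0 <= t -> vr t R1 th = 0;
  vr_outer : forall t th, 0 <= t -> vr t R2 th = 0;
  vth_outer : forall t th, 0 <= t -> vth t R2 th = 0;
  vth_inner_slip : forall t th, 0 <= t ->
    dr R1 R2 vth t R1 th = (1 / R1 - alpha / mu) * vth t R1 th
}.

Definition has_initial_value (R1 R2 : R) (f : field) (f0 : R -> R -> R) : Prop :=
  forall r th, R1 <= r <= R2 -> f 0 r th = f0 r th.

Definition exp_mode (lambda : R) (f0 : R -> R -> R) : field :=
  fun t r th => exp (lambda * t) * f0 r th.

(* Main.v *)
(** Only the first angular mode is needed: v_r = u(r) cos th, v_th = W(r) sin th,
    p = q(r) cos th, with growth rate l.  After elimination of the density, the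
    system is a linear ODE for (u, W, W', q), whose weak form is the quadratic form
    P_l = l^2 A + l mu E - B, where A is the kinetic energy, E >= 0 the dissipation
    (this is where 1 - alpha R1 / mu >= 0 enters) and B = int g rho' u^2 r.
    P_l takes a negative value for small l, on a bump around r_s, and is nonnegative
    for large l.  Let l be the supremum of the rates for which P_l takes a negative
    value; then P_l >= 0.  If the homogeneous problem had only the trivial solution
    at this l, the inhomogeneous one would be solvable for every forcing, and testing
    P_l >= 0 with v - s psi, psi the response to the forcing v, would give
    P_l >= c int v^2 r with c > 0.  This would persist for slightly smaller rates,
    contradicting the choice of l. *)

Require Import Defs.
From Stdlib Require Import Reals Lra Lia Classical.
From Coquelicot Require Import Coquelicot.

Open Scope R_scope.

(** The rate enters [P_l] both squared and linearly, so the critical rate is not an eigenvalue of a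
    fixed operator, and a minimiser of a Rayleigh quotient would call for compactness in Sobolev
    spaces. Here the only norm is [int v^2 r], and the Fredholm alternative reduces to a 2 x 2
    shooting determinant. If that determinant does not vanish, the response [psi] to [F] satisfies
    [P_l(psi, v) = l * int F v r] for the polarised form. With [F = v] and
    [int v psi r <= K * int v^2 r], the inequality [0 <= P_l(v - psi / K)] becomes
    [P_l(v) >= (l / K) * int v^2 r]. So weak a bound survives a small decrease of [l]: for
    [0 < t <= 1], [E >= 0] gives [P_(t l) >= t^2 (P_l + B) - B], and [B] is itself at most a
    constant times [int v^2 r]. Derivatives of [v] never have to be controlled. In the radial
    problem all derivatives at [R1] and [R2] are two-sided; the coefficients are therefore extended
    by constants to the whole line. *)

Definition clamp (a b x : R) : R := Rmax a (Rmin x b).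

Lemma clamp_in (a b x : R) : a <= b -> a <= clamp a b x <= b.
Proof.
  intros H; unfold clamp, Rmax, Rmin; repeat destruct Rle_dec; lra.
Qed.

Lemma clamp_id (a b x : R) : a <= x <= b -> clamp a b x = x.
Proof.
  intros H; unfold clamp, Rmax, Rmin; repeat destruct Rle_dec; lra.
Qed.

Lemma clamp_lipschitz (a b x y : R) :
  a <= b -> Rabs (clamp a b y - clamp a b x) <= Rabs (y - x).
Proof.
  intros H; unfold clamp, Rmax, Rmin, Rabs.
  repeat destruct Rle_dec; repeat destruct Rcase_abs; lra.
Qed.

Lemma continuous_plusR (f h : R -> R) (x : R) :
  continuous f x -> continuous h x -> continuous (fun y => f y + h y) x.
Proof. exact (continuous_plus (V := R_NormedModule) f h x). Qed.

Lemma continuous_minusR (f h : R -> R) (x : R) :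
  continuous f x -> continuous h x -> continuous (fun y => f y - h y) x.
Proof. exact (continuous_minus (V := R_NormedModule) f h x). Qed.

Lemma continuous_oppR (f : R -> R) (x : R) :
  continuous f x -> continuous (fun y => - f y) x.
Proof. exact (continuous_opp (V := R_NormedModule) f x). Qed.

Lemma continuous_multR (f h : R -> R) (x : R) :
  continuous f x -> continuous h x -> continuous (fun y => f y * h y) x.
Proof. exact (continuous_mult (K := R_AbsRing) f h x). Qed.

Lemma continuous_divR (f h : R -> R) (x : R) :
  continuous f x -> continuous h x -> h x <> 0 ->
  continuous (fun y => f y / h y) x.
Proof.
  intros Hf Hh H0; apply continuous_multR; trivial.
  apply continuous_comp; trivial; apply continuous_Rinv; trivial.
Qed.

Lemma continuous_powR (f : R -> R) (n : nat) (x : R) :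
  continuous f x -> continuous (fun y => f y ^ n) x.
Proof.
  intros Hf; induction n as [|n IH]; simpl.
  - apply continuous_const.
  - apply continuous_multR; trivial.
Qed.

Lemma is_derive_continuous (f : R -> R) (x l : R) :
  is_derive f x l -> continuous f x.
Proof. intros H; exact (ex_derive_continuous (V := R_NormedModule) f x (ex_intro _ l H)). Qed.

(** The constant case comes first, so subterms free of the variable are not taken apart.
    Nonvanishing of denominators and unrecognised atoms are left as goals. *)
Ltac cont :=
  cbv beta iota;
  match goal with
  | |- continuous (fun _ => ?c) _ => apply continuous_const
  | |- continuous (fun y => y) _ => apply continuous_id
  | |- continuous (fun y => @?f y + @?h y) ?x => apply (continuous_plusR f h x); cont
  | |- continuous (fun y => @?f y - @?h y) ?x => apply (continuous_minusR f h x); cont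
  | |- continuous (fun y => - @?f y) ?x => apply (continuous_oppR f x); cont
  | |- continuous (fun y => @?f y / @?h y) ?x => apply (continuous_divR f h x); [cont | cont | cbv beta]
  | |- continuous (fun y => @?f y ^ ?n) ?x => apply (continuous_powR f n x); cont
  | |- continuous (fun y => @?f y * @?h y) ?x => apply (continuous_multR f h x); cont
  | H : continuous ?f ?x |- continuous ?f ?x => exact H
  | H : forall y, continuous ?f y |- continuous ?f _ => apply H
  | |- continuous (fun y => ?f y) ?x => progress change (continuous f x); cont
  | _ => idtac
  end.

Lemma continuous_clamp (a b x : R) : a <= b -> continuous (clamp a b) x.
Proof.
  intros H; apply filterlim_locally; intros eps; exists eps; intros y Hy.
  apply Rle_lt_trans with (Rabs (y - x)); [|exact Hy].
  apply clamp_lipschitz; trivial.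
Qed.

(** Composition with [clamp] is the extension by constants: it agrees with [f] on the interval and
    makes continuity on the whole line available to the integrals and to the ODE solver. *)
Lemma continuous_comp_clamp (f : R -> R) (a b x : R) :
  a <= b -> (forall y, a <= y <= b -> continuous f y) ->
  continuous (fun y => f (clamp a b y)) x.
Proof.
  intros H Hf; apply continuous_comp.
  - apply continuous_clamp; trivial.
  - apply Hf, clamp_in; trivial.
Qed.

Lemma continuous_bounded (f : R -> R) (a b : R) :
  a <= b -> (forall x, a <= x <= b -> continuous f x) ->
  exists m, 0 <= m /\ forall x, a <= x <= b -> Rabs (f x) <= m.
Proof.
  intros H Hf.
  assert (Hc : forall x, a <= x <= b -> continuity_pt (fun y => Rabs (f y)) x).
  { intros x Hx; apply continuity_pt_filterlim.
    apply (continuous_comp f Rabs); [exact (Hf x Hx) | apply continuous_Rabs]. }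
  destruct (continuity_ab_maj (fun y => Rabs (f y)) a b H Hc) as [M [HM _]].
  exists (Rabs (f M)); split; [apply Rabs_pos | exact HM].
Qed.

Lemma le_of_derive_nonneg (f df : R -> R) (a b : R) :
  a <= b -> (forall x, a <= x <= b -> is_derive f x (df x)) ->
  (forall x, a <= x <= b -> 0 <= df x) -> f a <= f b.
Proof.
  intros H Hd Hp.
  destruct (MVT_gen f a b df) as [c [Hc E]].
  - intros x Hx; rewrite Rmin_left, Rmax_right in Hx by lra; apply Hd; lra.
  - intros x Hx; rewrite Rmin_left, Rmax_right in Hx by lra.
    apply continuity_pt_filterlim, (is_derive_continuous _ _ (df x)), Hd; lra.
  - rewrite Rmin_left, Rmax_right in Hc by lra.
    pose proof (Rmult_le_pos _ (b - a) (Hp c Hc)); lra.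
Qed.

(** Both [f - h] and [- f - h] are nondecreasing. The comparison runs downwards from [b] because
    Cauchy data will be prescribed at the right end. *)
Lemma abs_le_of_derive_le (f df h dh : R -> R) (a b : R) :
  a <= b -> (forall x, a <= x <= b -> is_derive f x (df x)) ->
  (forall x, a <= x <= b -> is_derive h x (dh x)) ->
  (forall x, a <= x <= b -> Rabs (df x) <= - dh x) ->
  Rabs (f a - f b) <= h a - h b.
Proof.
  intros H Hf Hh Hle.
  assert (H1 : - f a - h a <= - f b - h b).
  { apply (le_of_derive_nonneg (fun x => - f x - h x) (fun x => - df x - dh x)); trivial.
    - intros x Hx; apply (is_derive_minus (fun x => - f x) h x (- df x) (dh x)); auto.
      apply (is_derive_opp f); auto.
    - intros x Hx; specialize (Hle x Hx); apply Rabs_le_between in Hle; lra. }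
  assert (H2 : f a - h a <= f b - h b).
  { apply (le_of_derive_nonneg (fun x => f x - h x) (fun x => df x - dh x)); trivial.
    - intros x Hx; apply (is_derive_minus f h x (df x) (dh x)); auto.
    - intros x Hx; specialize (Hle x Hx); apply Rabs_le_between in Hle; lra. }
  apply Rabs_le; lra.
Qed.

Lemma geometric_steps_limit (u : nat -> R) (K : R) :
  (forall n, Rabs (u (S n) - u n) <= K * (/ 2) ^ n) ->
  forall n, Rabs (u n - real (Lim_seq u)) <= 2 * K * (/ 2) ^ n.
Proof.
  intros Hu.
  assert (HK : 0 <= K).
  { specialize (Hu 0%nat); simpl in Hu.
    pose proof (Rabs_pos (u 1%nat - u 0%nat)); lra. }
  (* The subtracted tail is what closes the induction on [k]: adding one step [K * (/ 2) ^ (n + k)]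
     exactly halves it. *)
  assert (Hd : forall n k, Rabs (u (n + k)%nat - u n) <= 2 * K * (/ 2) ^ n - 2 * K * (/ 2) ^ (n + k)).
  { intros n k; induction k as [|k IH].
    - rewrite Nat.add_0_r, !Rminus_diag, Rabs_R0; lra.
    - rewrite <- plus_n_Sm.
      replace (u (S (n + k)) - u n) with ((u (S (n + k)) - u (n + k)%nat) + (u (n + k)%nat - u n)) by ring.
      eapply Rle_trans; [apply Rabs_triang|].
      specialize (Hu (n + k)%nat); simpl; lra. }
  assert (Hp : forall n, 0 < (/ 2) ^ n) by (intros n; apply pow_lt; lra).
  assert (Hex : ex_finite_lim_seq u).
  { apply ex_lim_seq_cauchy_corr; intros eps.
    assert (Hl : is_lim_seq (fun n => 4 * K * (/ 2) ^ n) 0).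
    { replace (Finite 0) with (Rbar_mult (4 * K) 0) by (simpl; f_equal; ring).
      apply is_lim_seq_scal_l, is_lim_seq_geom; rewrite Rabs_pos_eq; lra. }
    apply is_lim_seq_spec in Hl; destruct (Hl eps) as [N HN].
    exists N; intros n m Hn Hm.
    specialize (HN N (le_n N)); rewrite Rminus_0_r in HN.
    apply Rle_lt_trans with (2 := HN); apply Rle_trans with (2 := Rle_abs _).
    pose proof (Hd N (n - N)%nat) as H1; pose proof (Hd N (m - N)%nat) as H2.
    replace (N + (n - N))%nat with n in H1 by lia.
    replace (N + (m - N))%nat with m in H2 by lia.
    pose proof (Rmult_le_pos _ _ HK (Rlt_le _ _ (Hp n))).
    pose proof (Rmult_le_pos _ _ HK (Rlt_le _ _ (Hp m))).
    apply Rabs_le_between in H1; apply Rabs_le_between in H2; apply Rabs_le; lra. }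
  destruct Hex as [l Hl]; rewrite (is_lim_seq_unique _ _ Hl); simpl.
  intros n; rewrite Rabs_minus_sym.
  apply (is_lim_seq_le (fun k => Rabs (u (n + k)%nat - u n)) (fun _ => 2 * K * (/ 2) ^ n)
           (Finite (Rabs (l - u n))) (Finite (2 * K * (/ 2) ^ n))).
  - intros k; specialize (Hd n k).
    pose proof (Rmult_le_pos _ _ HK (Rlt_le _ _ (Hp (n + k)%nat))); lra.
  - apply (is_lim_seq_abs _ (Finite (l - u n))), is_lim_seq_minus'; [|apply is_lim_seq_const].
    apply is_lim_seq_ext with (fun k => u (k + n)%nat); [intros k; f_equal; lia|].
    apply is_lim_seq_incr_n; trivial.
  - apply is_lim_seq_const.
Qed.

(** * Linear systems of ordinary differential equations *)

Lemma continuous_sum_f_R0 (f : nat -> R -> R) (N : nat) (x : R) :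
  (forall i, (i <= N)%nat -> continuous (f i) x) ->
  continuous (fun y => sum_f_R0 (fun i => f i y) N) x.
Proof.
  induction N as [|N IH]; intros H; simpl; [apply (H 0%nat); lia|].
  apply continuous_plusR; [apply IH; intros i Hi|]; apply H; lia.
Qed.

Lemma sum_f_R0_abs_le (f : nat -> R) (N : nat) (m : R) :
  (forall i, (i <= N)%nat -> Rabs (f i) <= m) ->
  Rabs (sum_f_R0 f N) <= m * INR (S N).
Proof.
  intros H; eapply Rle_trans; [apply Rsum_abs|].
  rewrite <- sum_cte; apply sum_Rle; intros i Hi; apply H; trivial.
Qed.

Lemma is_derive_RInt_cont (f : R -> R) (a x : R) :
  (forall y, continuous f y) -> is_derive (fun y => RInt f a y) x (f x).
Proof.
  intros H; apply is_derive_RInt with a; [|apply H].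
  exists (mkposreal 1 Rlt_0_1); intros y _.
  apply (RInt_correct (V := R_CompleteNormedModule) f a y), ex_RInt_continuous.
  intros z _; apply H.
Qed.

Lemma exists_common_bound (P : nat -> R -> Prop) (N : nat) :
  (forall i m m', P i m -> m <= m' -> P i m') ->
  (forall i, (i <= N)%nat -> exists m, 0 <= m /\ P i m) ->
  exists m, 0 <= m /\ forall i, (i <= N)%nat -> P i m.
Proof.
  intros Hmon; induction N as [|N IH]; intros H.
  - destruct (H 0%nat (le_n 0)) as [m [Hm Hp]]; exists m; split; trivial.
    intros i Hi; replace i with 0%nat by lia; trivial.
  - destruct IH as [m [Hm Hp]]; [intros i Hi; apply H; lia|].
    destruct (H (S N) (le_n _)) as [m' [Hm' Hp']].
    exists (m + m'); split; [lra|]; intros i Hi.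
    destruct (Nat.eq_dec i (S N)) as [->|Hne].
    + apply Hmon with m'; trivial; lra.
    + apply Hmon with m; [apply Hp; lia | lra].
Qed.

Definition affine_field (N : nat) (M : nat -> nat -> R -> R) (F : nat -> R -> R)
    (y : nat -> R -> R) (i : nat) (x : R) : R :=
  sum_f_R0 (fun j => M i j x * y j x) N + F i x.

(** Integration starts at [b], and the integrand is frozen outside [[a, b]] by [clamp]. Hence for
    continuous coefficients each iterate is differentiable on the whole line, with two-sided
    derivatives at [a] and [b]. *)
Fixpoint picard (N : nat) (M : nat -> nat -> R -> R) (F : nat -> R -> R)
    (a b : R) (y0 : nat -> R) (n : nat) (i : nat) (x : R) : R :=
  match n with
  | O => y0 i
  | S n => y0 i + RInt (fun s => affine_field N M F (picard N M F a b y0 n) i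
                                   (clamp a b s)) b x
  end.

Lemma continuous_affine_field_clamp (N : nat) M F y (a b x : R) (i : nat) :
  a <= b -> (i <= N)%nat ->
  (forall j z, (j <= N)%nat -> continuous (M i j) z) ->
  (forall z, continuous (F i) z) ->
  (forall j z, (j <= N)%nat -> continuous (fun s => y j (clamp a b s)) z) ->
  continuous (fun s => affine_field N M F y i (clamp a b s)) x.
Proof.
  intros Hab Hi HM HF Hy; unfold affine_field; apply continuous_plusR.
  - apply (continuous_sum_f_R0 (fun j s => M i j (clamp a b s) * y j (clamp a b s))).
    intros j Hj; apply continuous_multR.
    + apply (continuous_comp_clamp (M i j)); auto.
    + apply Hy; auto.
  - apply (continuous_comp_clamp (F i)); auto.
Qed.

Lemma affine_field_diff_le (N : nat) M F y z (i : nat) (x m e : R) :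
  0 <= m ->
  (forall j, (j <= N)%nat -> Rabs (M i j x) <= m) ->
  (forall j, (j <= N)%nat -> Rabs (y j x - z j x) <= e) ->
  Rabs (affine_field N M F y i x - affine_field N M F z i x) <= m * INR (S N) * e.
Proof.
  intros Hm HM Hd; unfold affine_field.
  replace (_ - _) with (sum_f_R0 (fun j => M i j x * (y j x - z j x)) N).
  - replace (m * INR (S N) * e) with (m * e * INR (S N)) by ring.
    apply sum_f_R0_abs_le; intros j Hj; rewrite Rabs_mult.
    apply Rmult_le_compat; auto using Rabs_pos.
  - transitivity (sum_f_R0 (fun j => M i j x * y j x - M i j x * z j x) N).
    + apply sum_eq; intros; ring.
    + rewrite minus_sum; ring.
Qed.

(* The weight [exp (L * (b - x))] makes the Picard iteration a contraction by
   the factor 1/2, whatever the length of the interval. *)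
Lemma linear_ode (N : nat) (M : nat -> nat -> R -> R) (F : nat -> R -> R)
    (a b : R) (y0 : nat -> R) :
  a <= b ->
  (forall i j x, (i <= N)%nat -> (j <= N)%nat -> continuous (M i j) x) ->
  (forall i x, (i <= N)%nat -> continuous (F i) x) ->
  exists y, forall i, (i <= N)%nat ->
    y i b = y0 i /\
    forall x, a <= x <= b -> is_derive (y i) x (affine_field N M F y i x).
Proof.
  intros Hab HM HF.
  set (Y := picard N M F a b y0).
  assert (HY : forall n i, (i <= N)%nat -> forall x, continuous (Y n i) x).
  { intros n; induction n as [|n IH]; intros i Hi x; [apply continuous_const|].
    unfold Y; simpl; apply continuous_plusR; [apply continuous_const|].
    eapply is_derive_continuous, is_derive_RInt_cont.
    intros z; apply continuous_affine_field_clamp; auto.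
    intros j s Hj; apply (continuous_comp_clamp (Y n j)); auto. }
  assert (HYc : forall n j, (j <= N)%nat -> forall x, continuous (fun s => Y n j (clamp a b s)) x).
  { intros n j Hj x; apply (continuous_comp_clamp (Y n j)); auto. }
  assert (HD : forall n i, (i <= N)%nat -> forall x,
    is_derive (Y (S n) i) x (affine_field N M F (Y n) i (clamp a b x))).
  { intros n i Hi x; unfold Y; simpl.
    evar_last.
    - apply (is_derive_plus (fun _ => y0 i)); [apply is_derive_const|].
      apply is_derive_RInt_cont; intros z; apply continuous_affine_field_clamp; auto.
    - apply plus_zero_l. }
  assert (Hb : forall n i, Y n i b = y0 i).
  { intros [|n] i; unfold Y; simpl; trivial. rewrite RInt_point; apply Rplus_0_r. }
  destruct (exists_common_bound (fun i m => forall j, (j <= N)%nat -> forall x, a <= x <= b -> Rabs (M i j x) <= m) N)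
    as [m [Hm HMm]].
  { intros i m m' H1 H2 j Hj x Hx; apply Rle_trans with m; auto. }
  { intros i Hi.
    apply (exists_common_bound (fun j m => forall x, a <= x <= b -> Rabs (M i j x) <= m) N).
    - intros j m m' H1 H2 x Hx; apply Rle_trans with m; auto.
    - intros j Hj; apply continuous_bounded; auto. }
  destruct (exists_common_bound (fun i m => forall x, a <= x <= b -> Rabs (Y 1%nat i x - Y 0%nat i x) <= m) N)
    as [K [HK HK0]].
  { intros i k k' H1 H2 x Hx; apply Rle_trans with k; auto. }
  { intros i Hi; apply (continuous_bounded (fun x => Y 1%nat i x - Y 0%nat i x)); trivial.
    intros x _; apply continuous_minusR; apply HY; trivial. }
  assert (HN : 0 < INR (S N)) by (apply lt_0_INR; lia).
  pose proof (Rmult_le_pos m (INR (S N)) Hm (Rlt_le _ _ HN)) as HmN.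
  (* Integrating [m * INR (S N) * exp (L * (b - s))] gains a factor [1 / L], so
     [L >= 2 * m * INR (S N)] yields the contraction factor 1/2; the [+ 1] keeps [L] positive when
     [m = 0]. *)
  set (L := 2 * (m * INR (S N)) + 1).
  assert (HL : 0 < L) by (unfold L; lra).
  assert (Hp : forall n, 0 < (/ 2) ^ n) by (intros n; apply pow_lt; lra).
  assert (Hstep : forall n i x, (i <= N)%nat -> a <= x <= b ->
    Rabs (Y (S n) i x - Y n i x) <= K * (/ 2) ^ n * exp (L * (b - x))).
  { intros n; induction n as [|n IH]; intros i x Hi Hx.
    - assert (1 <= exp (L * (b - x))).
      { rewrite <- exp_0; assert (0 <= L * (b - x)) by (apply Rmult_le_pos; lra).
        destruct (Req_dec 0 (L * (b - x))) as [<-|]; [lra|left; apply exp_increasing; lra]. }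
      simpl (_ ^ 0); rewrite Rmult_1_r; apply Rle_trans with K; [apply HK0; trivial|].
      rewrite <- (Rmult_1_r K) at 1; apply Rmult_le_compat_l; trivial.
    - set (c := K * (/ 2) ^ S n).
      assert (Hc : 0 <= c) by (apply Rmult_le_pos; [|left]; auto).
      pose proof (abs_le_of_derive_le
        (fun s => Y (S (S n)) i s - Y (S n) i s)
        (fun s => affine_field N M F (Y (S n)) i (clamp a b s) - affine_field N M F (Y n) i (clamp a b s))
        (fun s => c * exp (L * (b - s)))
        (fun s => - (L * c * exp (L * (b - s)))) x b) as H.
      cbv beta in H; rewrite !Hb, Rminus_diag, Rminus_0_r in H.
      eapply Rle_trans; [apply H; clear H|].
      + lra.
      + intros s Hs; apply (is_derive_minus (Y (S (S n)) i) (Y (S n) i)); apply HD; trivial.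
      + intros s Hs; auto_derive; trivial; unfold Rminus; ring.
      + intros s Hs; rewrite Ropp_involutive, clamp_id by lra.
        eapply Rle_trans.
        * apply affine_field_diff_le with (m := m); [trivial| |].
          -- intros j Hj; apply HMm; trivial; lra.
          -- intros j Hj; apply IH; trivial; lra.
        * pose proof (exp_pos (L * (b - s))) as He.
          assert (0 <= c * exp (L * (b - s))) by (apply Rmult_le_pos; lra).
          replace (K * (/ 2) ^ n) with (2 * c) by (unfold c; simpl; field).
          unfold L at 2; nra.
      + rewrite Rminus_diag, Rmult_0_r, exp_0; lra. }
  set (K' := K * exp (L * (b - a))).
  assert (HK' : 0 <= K') by (apply Rmult_le_pos; [|left; apply exp_pos]; trivial).
  set (Yl := fun i x => real (Lim_seq (fun n => Y n i x))).
  assert (Hlim : forall n i x, (i <= N)%nat -> a <= x <= b ->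
    Rabs (Y n i x - Yl i x) <= 2 * K' * (/ 2) ^ n).
  { intros n i x Hi Hx.
    apply (geometric_steps_limit (fun n => Y n i x)); clear n; intros n.
    eapply Rle_trans; [apply Hstep; trivial|].
    replace (K' * (/ 2) ^ n) with (K * (/ 2) ^ n * exp (L * (b - a))) by (unfold K'; ring).
    apply Rmult_le_compat_l; [apply Rmult_le_pos; [|left]; auto|].
    destruct (Req_dec a x) as [<-|]; [lra|left; apply exp_increasing, Rmult_lt_compat_l; lra]. }
  assert (Hsmall : forall C eps, 0 < eps -> exists n0, forall n, (n0 <= n)%nat -> C * (/ 2) ^ n < eps).
  { intros C eps He.
    assert (Hl : is_lim_seq (fun n => C * (/ 2) ^ n) 0).
    { replace (Finite 0) with (Rbar_mult C 0) by (simpl; f_equal; ring).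
      apply is_lim_seq_scal_l, is_lim_seq_geom; rewrite Rabs_pos_eq; lra. }
    apply is_lim_seq_spec in Hl; destruct (Hl (mkposreal _ He)) as [n0 Hn0].
    exists n0; intros n Hn; specialize (Hn0 n Hn); rewrite Rminus_0_r in Hn0.
    eapply Rle_lt_trans; [apply Rle_abs | exact Hn0]. }
  assert (HYlc : forall i, (i <= N)%nat -> forall x, continuous (fun s => Yl i (clamp a b s)) x).
  { intros i Hi x; apply continuity_pt_filterlim.
    apply (CVU_continuity (fun n s => Y n i (clamp a b s)) _ x (mkposreal 1 Rlt_0_1)).
    - intros eps He; destruct (Hsmall (2 * K') eps He) as [n0 Hn0].
      exists n0; intros n y Hn _; rewrite Rabs_minus_sym.
      eapply Rle_lt_trans; [apply Hlim, clamp_in; trivial | apply Hn0; trivial].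
    - intros n y _; apply continuity_pt_filterlim; apply (HYc n i Hi).
    - unfold Boule; rewrite Rminus_diag, Rabs_R0; simpl; lra. }
  (* The pointwise limit [Yl] is only known to be continuous. Integrating the field along it once
     more produces a differentiable function, identified with [Yl] on [[a, b]] below. *)
  set (y := fun i x => y0 i + RInt (fun s => affine_field N M F Yl i (clamp a b s)) b x).
  assert (Hy : forall i x, (i <= N)%nat ->
    is_derive (y i) x (affine_field N M F Yl i (clamp a b x))).
  { intros i x Hi; unfold y; evar_last.
    - apply (is_derive_plus (fun _ => y0 i)); [apply is_derive_const|].
      apply is_derive_RInt_cont; intros z; apply continuous_affine_field_clamp; auto.
    - apply plus_zero_l. }
  assert (Hyb : forall i, y i b = y0 i).
  { intros i; unfold y; rewrite RInt_point; apply Rplus_0_r. }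
  assert (Heq : forall i x, (i <= N)%nat -> a <= x <= b -> y i x = Yl i x).
  { intros i x Hi Hx.
    apply cond_eq; intros eps He.
    set (C := m * INR (S N) * (2 * K')).
    (* The first summand controls the distance from [y] to the iterate [S n], the second the
       distance from that iterate to [Yl]. *)
    destruct (Hsmall (C * (b - x) + 2 * K') eps He) as [n Hn].
    specialize (Hn n (le_n n)).
    assert (H1 : Rabs (y i x - Y (S n) i x) <= C * (/ 2) ^ n * (b - x)).
    { pose proof (abs_le_of_derive_le
        (fun s => y i s - Y (S n) i s)
        (fun s => affine_field N M F Yl i (clamp a b s) - affine_field N M F (Y n) i (clamp a b s))
        (fun s => C * (/ 2) ^ n * (b - s))
        (fun s => - (C * (/ 2) ^ n)) x b) as H.
      cbv beta in H; rewrite Hb, Hyb, !Rminus_diag, Rmult_0_r, !Rminus_0_r in H.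
      apply H; clear H.
      - lra.
      - intros s Hs; apply (is_derive_minus (y i) (Y (S n) i)); [apply Hy | apply HD]; trivial.
      - intros s Hs; auto_derive; trivial; ring.
      - intros s Hs; rewrite Ropp_involutive, clamp_id by lra.
        replace (C * (/ 2) ^ n) with (m * INR (S N) * (2 * K' * (/ 2) ^ n)) by (unfold C; ring).
        apply affine_field_diff_le; [trivial| |].
        + intros j Hj; apply HMm; trivial; lra.
        + intros j Hj; rewrite Rabs_minus_sym; apply Hlim; trivial; lra. }
    pose proof (Hlim (S n) i x Hi Hx) as H2; simpl in H2.
    replace (y i x - Yl i x) with ((y i x - Y (S n) i x) + (Y (S n) i x - Yl i x)) by ring.
    eapply Rle_lt_trans; [apply Rabs_triang|].
    pose proof (Rmult_le_pos _ _ HK' (Rlt_le _ _ (Hp n))); nra. }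
  exists y; intros i Hi; split; [apply Hyb|]; intros x Hx.
  replace (affine_field N M F y i x) with (affine_field N M F Yl i (clamp a b x)); [apply Hy; trivial|].
  rewrite clamp_id by trivial; unfold affine_field; f_equal.
  apply sum_eq; intros j Hj; rewrite Heq; trivial.
Qed.

(** * The radial equations of the first angular mode *)

(* Amplitudes of [v_r = u cos th], [v_th = W sin th], [p = q cos th] at growth rate
   [l]: incompressibility, [Z = W'], and the two momentum equations, the radial one
   with a forcing [F].  [G] stands for [g * rho'], which enters through the density
   amplitude [- u rho' / l]. *)
Definition mode_ode (R1 R2 mu l : R) (rho G F : R -> R) (u W Z q : R -> R) : Prop :=
  forall x, R1 <= x <= R2 ->
    is_derive u x (- (u x + W x) / x)
    /\ is_derive W x (Z x)
    /\ is_derive Z x (l * rho x * W x / mu - Z x / x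
                      + 2 * (u x + W x) / x ^ 2 - q x / (mu * x))
    /\ is_derive q x (- mu * (Z x / x + (u x + W x) / x ^ 2)
                      - l * rho x * u x + G x * u x / l + F x).

Lemma mode_ode_exists (R1 R2 mu l : R) (rho G F : R -> R) (u0 W0 Z0 q0 : R) :
  0 < R1 -> R1 < R2 -> 0 < mu -> 0 < l ->
  (forall x, continuous rho x) -> (forall x, continuous G x) ->
  (forall x, continuous F x) ->
  exists u W Z q, mode_ode R1 R2 mu l rho G F u W Z q
    /\ u R2 = u0 /\ W R2 = W0 /\ Z R2 = Z0 /\ q R2 = q0.
Proof.
  intros h1 h12 hmu hl hrho hG hF.
  set (c := clamp R1 R2).
  assert (hcc : forall x, continuous c x) by (intros x; apply continuous_clamp; lra).
  assert (hcp : forall x, c x <> 0).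
  { intros x; pose proof (clamp_in R1 R2 x (Rlt_le _ _ h12)); unfold c; lra. }
  (* Indices 0, 1, 2, 3 stand for [u], [W], [Z], [q]. Dividing by [c x] instead of [x] makes the
     entries continuous on the whole line, since [c] takes values in [[R1, R2]]. *)
  set (M := fun (i j : nat) (x : R) =>
    match i, j with
    | 0%nat, 0%nat | 0%nat, 1%nat => - (1 / c x)
    | 1%nat, 2%nat => 1
    | 2%nat, 0%nat => 2 / c x ^ 2
    | 2%nat, 1%nat => l * rho x / mu + 2 / c x ^ 2
    | 2%nat, 2%nat => - (1 / c x)
    | 2%nat, 3%nat => - (1 / (mu * c x))
    | 3%nat, 0%nat => - (mu / c x ^ 2) - l * rho x + G x / l
    | 3%nat, 1%nat => - (mu / c x ^ 2)
    | 3%nat, 2%nat => - (mu / c x)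
    | _, _ => 0
    end).
  set (y0 := fun i : nat => match i with 0%nat => u0 | 1%nat => W0 | 2%nat => Z0 | _ => q0 end).
  destruct (linear_ode 3 M (fun i x => match i with 3%nat => F x | _ => 0 end) R1 R2 y0)
    as [y Hy].
  - lra.
  - intros i j x Hi Hj.
    assert (c x ^ 2 <> 0) by (apply pow_nonzero; trivial).
    assert (mu * c x <> 0) by (apply Rmult_integral_contrapositive_currified; [lra|trivial]).
    unfold M; destruct i as [|[|[|[|i]]]]; [ | | | |lia];
      destruct j as [|[|[|[|j]]]]; [ | | | |lia| | | | |lia| | | | |lia| | | | |lia].
    all: cont.
    all: trivial.
    all: try lra.
  - intros i x Hi; destruct i as [|[|[|[|i]]]]; try lia; cont; trivial.
  - exists (y 0%nat), (y 1%nat), (y 2%nat), (y 3%nat).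
    assert (H0 := Hy 0%nat ltac:(lia)); assert (H1 := Hy 1%nat ltac:(lia)).
    assert (H2 := Hy 2%nat ltac:(lia)); assert (H3 := Hy 3%nat ltac:(lia)).
    split; [|intuition].
    intros x Hx; assert (hx : c x = x) by (apply clamp_id; trivial).
    split; [|split; [|split]].
    + evar_last; [apply H0; trivial|]; unfold affine_field, M; simpl; rewrite hx; field; lra.
    + evar_last; [apply H1; trivial|]; unfold affine_field, M; simpl; ring.
    + evar_last; [apply H2; trivial|]; unfold affine_field, M; simpl; rewrite hx; field; lra.
    + evar_last; [apply H3; trivial|]; unfold affine_field, M; simpl; rewrite hx; field; lra.
Qed.

Lemma is_derive_lincomb (f0 f1 f2 : R -> R) (c1 c2 x d0 d1 d2 : R) :
  is_derive f0 x d0 -> is_derive f1 x d1 -> is_derive f2 x d2 ->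
  is_derive (fun y => f0 y + c1 * f1 y + c2 * f2 y) x (d0 + c1 * d1 + c2 * d2).
Proof.
  intros H0 H1 H2.
  apply (is_derive_plus (fun y => f0 y + c1 * f1 y) (fun y => c2 * f2 y) x (d0 + c1 * d1) (c2 * d2)).
  - apply (is_derive_plus f0 (fun y => c1 * f1 y) x d0 (c1 * d1)); trivial.
    apply (is_derive_scal f1); trivial.
  - apply (is_derive_scal f2); trivial.
Qed.

Lemma mode_ode_lincomb (R1 R2 mu l : R) (rho G F : R -> R) (c1 c2 : R)
    (u0 W0 Z0 q0 u1 W1 Z1 q1 u2 W2 Z2 q2 : R -> R) :
  0 < R1 -> 0 < mu -> 0 < l ->
  mode_ode R1 R2 mu l rho G F u0 W0 Z0 q0 ->
  mode_ode R1 R2 mu l rho G (fun _ => 0) u1 W1 Z1 q1 ->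
  mode_ode R1 R2 mu l rho G (fun _ => 0) u2 W2 Z2 q2 ->
  mode_ode R1 R2 mu l rho G F
    (fun x => u0 x + c1 * u1 x + c2 * u2 x) (fun x => W0 x + c1 * W1 x + c2 * W2 x)
    (fun x => Z0 x + c1 * Z1 x + c2 * Z2 x) (fun x => q0 x + c1 * q1 x + c2 * q2 x).
Proof.
  intros h1 hmu hl H0 H1 H2 x Hx.
  destruct (H0 x Hx) as [? [? [? ?]]]; destruct (H1 x Hx) as [? [? [? ?]]];
    destruct (H2 x Hx) as [? [? [? ?]]].
  split; [|split; [|split]]; (evar_last; [apply is_derive_lincomb; eassumption|]; field; lra).
Qed.

(** * A priori bound for the radial Cauchy problem *)

Lemma abs_lincomb4_le (m c1 c2 c3 c4 u W Z q : R) :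
  Rabs c1 <= m -> Rabs c2 <= m -> Rabs c3 <= m -> Rabs c4 <= m ->
  Rabs (c1 * u + c2 * W + c3 * Z + c4 * q) <= m * (Rabs u + Rabs W + Rabs Z + Rabs q).
Proof.
  intros H1 H2 H3 H4.
  assert (H : forall c z, Rabs c <= m -> Rabs (c * z) <= m * Rabs z).
  { intros c z Hc; rewrite Rabs_mult; apply Rmult_le_compat_r; [apply Rabs_pos|trivial]. }
  pose proof (H _ u H1); pose proof (H _ W H2); pose proof (H _ Z H3); pose proof (H _ q H4).
  eapply Rle_trans; [apply Rabs_triang|].
  pose proof (Rabs_triang (c1 * u + c2 * W) (c3 * Z)); pose proof (Rabs_triang (c1 * u) (c2 * W)); lra.
Qed.

(** Here [u W Z q F] are numbers, not functions: the constant comes from the coefficients alone and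
    is uniform over all solutions and forcings. *)
Lemma mode_ode_rhs_bound (R1 R2 mu l : R) (rho G : R -> R) :
  0 < R1 -> R1 < R2 -> 0 < mu -> 0 < l ->
  (forall x, continuous rho x) -> (forall x, continuous G x) ->
  exists m, 0 <= m /\ forall x u W Z q F, R1 <= x <= R2 ->
    Rabs (- (u + W) / x) <= m * (Rabs u + Rabs W + Rabs Z + Rabs q) /\
    Rabs Z <= m * (Rabs u + Rabs W + Rabs Z + Rabs q) /\
    Rabs (l * rho x * W / mu - Z / x + 2 * (u + W) / x ^ 2 - q / (mu * x))
      <= m * (Rabs u + Rabs W + Rabs Z + Rabs q) /\
    Rabs (- mu * (Z / x + (u + W) / x ^ 2) - l * rho x * u + G x * u / l + F)
      <= m * (Rabs u + Rabs W + Rabs Z + Rabs q) + Rabs F.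
Proof.
  intros h1 h12 hmu hl hrho hG.
  (* The list collects the distinct coefficients of the system, up to sign. Index 8 falls into the
     default case: it is the zero coefficient that pads each row to four entries. *)
  destruct (exists_common_bound (fun k m => forall x, R1 <= x <= R2 -> Rabs (
    match k with
    | 0%nat => - (1 / x)
    | 1%nat => 1
    | 2%nat => 2 / x ^ 2
    | 3%nat => l * rho x / mu + 2 / x ^ 2
    | 4%nat => - (1 / (mu * x))
    | 5%nat => - (mu / x ^ 2) - l * rho x + G x / l
    | 6%nat => - (mu / x ^ 2)
    | 7%nat => - (mu / x)
    | _ => 0 end) <= m) 8) as [m [Hm H]].
  { intros i m m' Ha Hb x Hx; apply Rle_trans with m; auto. }
  { intros i Hi; apply (continuous_bounded (fun x => 
    match i with
    | 0%nat => - (1 / x)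
    | 1%nat => 1
    | 2%nat => 2 / x ^ 2
    | 3%nat => l * rho x / mu + 2 / x ^ 2
    | 4%nat => - (1 / (mu * x))
    | 5%nat => - (mu / x ^ 2) - l * rho x + G x / l
    | 6%nat => - (mu / x ^ 2)
    | 7%nat => - (mu / x)
    | _ => 0 end)); [lra|].
    intros x Hx.
    assert (x ^ 2 <> 0) by (apply pow_nonzero; lra).
    assert (mu * x <> 0) by (apply Rmult_integral_contrapositive_currified; lra).
    destruct i as [|[|[|[|[|[|[|[|i]]]]]]]]; cont; trivial; try lra. }
  exists m; split; trivial; intros x u W Z q F Hx.
  assert (B := fun k Hk => H k Hk x Hx); clear H.
  assert (B0 := B 0%nat ltac:(lia)); assert (B1 := B 1%nat ltac:(lia));
  assert (B2 := B 2%nat ltac:(lia)); assert (B3 := B 3%nat ltac:(lia));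
  assert (B4 := B 4%nat ltac:(lia)); assert (B5 := B 5%nat ltac:(lia));
  assert (B6 := B 6%nat ltac:(lia)); assert (B7 := B 7%nat ltac:(lia));
  assert (B8 := B 8%nat ltac:(lia)); clear B.
  cbv beta match in B0, B1, B2, B3, B4, B5, B6, B7, B8.
  repeat split.
  - eapply Rle_trans; [|apply (abs_lincomb4_le m _ _ _ _ u W Z q B0 B0 B8 B8)].
    right; f_equal; field; lra.
  - eapply Rle_trans; [|apply (abs_lincomb4_le m _ _ _ _ u W Z q B8 B8 B1 B8)].
    right; f_equal; ring.
  - eapply Rle_trans; [|apply (abs_lincomb4_le m _ _ _ _ u W Z q B2 B3 B0 B4)].
    right; f_equal; field; lra.
  - eapply Rle_trans; [apply Rabs_triang|apply Rplus_le_compat_r].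
    eapply Rle_trans; [|apply (abs_lincomb4_le m _ _ _ _ u W Z q B5 B6 B7 B8)].
    right; f_equal; field; lra.
Qed.

(** Cauchy-Schwarz on four terms gives the factor 4, and [2 |q| |F| <= s ^ 2 + F ^ 2], with [s] the
    sum of the absolute values, accounts for the [+ 1]. The minus sign suits integration downwards
    from the right end. *)
Lemma gronwall_step (m u W Z q du dW dZ dq F : R) :
  0 <= m ->
  Rabs du <= m * (Rabs u + Rabs W + Rabs Z + Rabs q) ->
  Rabs dW <= m * (Rabs u + Rabs W + Rabs Z + Rabs q) ->
  Rabs dZ <= m * (Rabs u + Rabs W + Rabs Z + Rabs q) ->
  Rabs dq <= m * (Rabs u + Rabs W + Rabs Z + Rabs q) + Rabs F ->
  - (2 * (u * du + W * dW + Z * dZ + q * dq))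
    <= 4 * (2 * m + 1) * (u ^ 2 + W ^ 2 + Z ^ 2 + q ^ 2) + F ^ 2.
Proof.
  intros Hm H1 H2 H3 H4.
  set (s := Rabs u + Rabs W + Rabs Z + Rabs q) in *.
  assert (H : forall c z k, Rabs c <= k -> - (z * c) <= Rabs z * k).
  { intros c z k Hc; eapply Rle_trans; [apply Rle_abs|].
    rewrite Rabs_Ropp, Rabs_mult; apply Rmult_le_compat_l; [apply Rabs_pos|trivial]. }
  pose proof (H _ u _ H1); pose proof (H _ W _ H2); pose proof (H _ Z _ H3); pose proof (H _ q _ H4).
  rewrite <- (pow2_abs u), <- (pow2_abs W), <- (pow2_abs Z), <- (pow2_abs q), <- (pow2_abs F).
  pose proof (Rabs_pos u); pose proof (Rabs_pos W); pose proof (Rabs_pos Z); pose proof (Rabs_pos q).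
  assert (Hs : s ^ 2 <= 4 * (Rabs u ^ 2 + Rabs W ^ 2 + Rabs Z ^ 2 + Rabs q ^ 2)).
  { unfold s; generalize (Rabs u) (Rabs W) (Rabs Z) (Rabs q); intros x y z t.
    pose proof (pow2_ge_0 (x - y)); pose proof (pow2_ge_0 (x - z)); pose proof (pow2_ge_0 (x - t));
    pose proof (pow2_ge_0 (y - z)); pose proof (pow2_ge_0 (y - t)); pose proof (pow2_ge_0 (z - t)); nra. }
  assert (Hq : Rabs q * Rabs F * 2 <= s ^ 2 + Rabs F ^ 2).
  { pose proof (pow2_ge_0 (s - Rabs F)); pose proof (Rabs_pos F).
    assert (Rabs q <= s) by (unfold s; lra). nra. }
  assert (E : Rabs u * (m * s) + Rabs W * (m * s) + Rabs Z * (m * s) + Rabs q * (m * s) = m * s ^ 2)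
    by (unfold s; ring).
  assert ((2 * m + 1) * s ^ 2 <= (2 * m + 1) * (4 * (Rabs u ^ 2 + Rabs W ^ 2 + Rabs Z ^ 2 + Rabs q ^ 2)))
    by (apply Rmult_le_compat_l; lra).
  lra.
Qed.

(** Gronwall from [R2]: the energy weighted by [exp (K * (x - R1))], plus a multiple of the running
    integral of [F ^ 2], is nondecreasing, and the energy vanishes at [R2]. The weight lies between
    1 and the final constant. *)
Lemma mode_ode_bound (R1 R2 mu l : R) (rho G : R -> R) :
  0 < R1 -> R1 < R2 -> 0 < mu -> 0 < l ->
  (forall x, continuous rho x) -> (forall x, continuous G x) ->
  exists C, 0 <= C /\ forall F u W Z q,
    (forall x, continuous F x) -> mode_ode R1 R2 mu l rho G F u W Z q ->
    u R2 = 0 -> W R2 = 0 -> Z R2 = 0 -> q R2 = 0 ->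
    forall x, R1 <= x <= R2 ->
      u x ^ 2 + W x ^ 2 + Z x ^ 2 + q x ^ 2 <= C * RInt (fun s => F s ^ 2) R1 R2.
Proof.
  intros h1 h12 hmu hl hrho hG.
  destruct (mode_ode_rhs_bound R1 R2 mu l rho G h1 h12 hmu hl hrho hG) as [m [Hm HB]].
  set (K := 4 * (2 * m + 1)).
  exists (exp (K * (R2 - R1))); split; [left; apply exp_pos|].
  intros F u W Z q HF Hode Eu EW EZ Eq x Hx.
  set (I := fun y => RInt (fun s => F s ^ 2) R1 y).
  assert (HI : forall y, is_derive I y (F y ^ 2)).
  { intros y; apply (is_derive_RInt_cont (fun s => F s ^ 2)); intros z; cont; apply HF. }
  set (n := fun y => u y ^ 2 + W y ^ 2 + Z y ^ 2 + q y ^ 2).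
  assert (H : n x * exp (K * (x - R1)) + exp (K * (R2 - R1)) * I x
              <= n R2 * exp (K * (R2 - R1)) + exp (K * (R2 - R1)) * I R2).
  { apply (le_of_derive_nonneg
      (fun y => n y * exp (K * (y - R1)) + exp (K * (R2 - R1)) * I y)
      (fun y => (2 * (u y * (- (u y + W y) / y) + W y * Z y
                 + Z y * (l * rho y * W y / mu - Z y / y + 2 * (u y + W y) / y ^ 2 - q y / (mu * y))
                 + q y * (- mu * (Z y / y + (u y + W y) / y ^ 2) - l * rho y * u y + G y * u y / l + F y))
                 + K * n y) * exp (K * (y - R1)) + exp (K * (R2 - R1)) * F y ^ 2)).
    - lra.
    - intros y Hy; destruct (Hode y ltac:(lra)) as [D1 [D2 [D3 D4]]].
      unfold n; pose proof (HI y) as D5.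
      auto_derive.
      + repeat split; eexists; eassumption.
      + erewrite !(is_derive_unique (fun x : R => u x)), !(is_derive_unique (fun x : R => W x)), !(is_derive_unique (fun x : R => Z x)),
          !(is_derive_unique (fun x : R => q x)), !(is_derive_unique (fun x : R => I x)) by eassumption.
        unfold Rminus; ring.
    - intros y Hy.
      destruct (HB y (u y) (W y) (Z y) (q y) (F y) ltac:(lra)) as [B1 [B2 [B3 B4]]].
      pose proof (gronwall_step m _ _ _ _ _ _ _ _ _ Hm B1 B2 B3 B4) as Hg.
      fold K in Hg; fold (n y) in Hg.
      assert (He : exp (K * (y - R1)) <= exp (K * (R2 - R1))).
      { assert (K * (y - R1) <= K * (R2 - R1)) by (apply Rmult_le_compat_l; unfold K; lra).
        destruct (Req_dec (K * (y - R1)) (K * (R2 - R1))) as [->|]; [lra|left; apply exp_increasing; lra]. }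
      pose proof (exp_pos (K * (y - R1))); pose proof (pow2_ge_0 (F y)).
      match goal with |- 0 <= ?a * _ + _ => assert (- (F y ^ 2) <= a) by lra end.
      nra. }
  assert (HnR2 : n R2 = 0) by (unfold n; rewrite Eu, EW, EZ, Eq; ring).
  assert (HIx : 0 <= I x).
  { apply RInt_ge_0; [lra| |intros; apply pow2_ge_0].
    apply (ex_RInt_continuous (V := R_CompleteNormedModule)); intros; cont; apply HF. }
  assert (1 <= exp (K * (x - R1))).
  { assert (0 <= K * (x - R1)) by (apply Rmult_le_pos; unfold K; lra).
    rewrite <- exp_0; destruct (Req_dec 0 (K * (x - R1))) as [<-|]; [lra|left; apply exp_increasing; lra]. }
  pose proof (exp_pos (K * (R2 - R1))).
  change (n x <= exp (K * (R2 - R1)) * I R2).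
  assert (0 <= n x).
  { unfold n; pose proof (pow2_ge_0 (u x)); pose proof (pow2_ge_0 (W x)); pose proof (pow2_ge_0 (Z x));
    pose proof (pow2_ge_0 (q x)); lra. }
  assert (0 <= exp (K * (R2 - R1)) * I x) by (apply Rmult_le_pos; lra).
  rewrite HnR2 in H; nra.
Qed.

(** * Weak form *)

Lemma RInt_add_scal (f h : R -> R) (c a b : R) :
  a <= b -> (forall x, a <= x <= b -> continuous f x) ->
  (forall x, a <= x <= b -> continuous h x) ->
  RInt (fun x => f x + c * h x) a b = RInt f a b + c * RInt h a b.
Proof.
  intros Hab Hf Hh; apply is_RInt_unique.
  assert (If : is_RInt f a b (RInt f a b)).
  { apply (RInt_correct (V := R_CompleteNormedModule)), ex_RInt_continuous.
    intros z; rewrite Rmin_left, Rmax_right by lra; apply Hf. }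
  assert (Ih : is_RInt h a b (RInt h a b)).
  { apply (RInt_correct (V := R_CompleteNormedModule)), ex_RInt_continuous.
    intros z; rewrite Rmin_left, Rmax_right by lra; apply Hh. }
  apply (is_RInt_plus f (fun x => c * h x) a b _ (c * RInt h a b)); trivial.
  apply (is_RInt_scal h a b c); trivial.
Qed.

Lemma RInt_ext_le (f h : R -> R) (a b : R) :
  a <= b -> (forall x, a <= x <= b -> f x = h x) -> RInt f a b = RInt h a b.
Proof.
  intros Hab H; apply RInt_ext; intros x; rewrite Rmin_left, Rmax_right by lra.
  intros Hx; apply H; lra.
Qed.

Lemma RInt_nonneg (f : R -> R) (a b : R) :
  a <= b -> (forall x, a <= x <= b -> continuous f x) ->
  (forall x, a <= x <= b -> 0 <= f x) -> 0 <= RInt f a b.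
Proof.
  intros Hab Hf Hp; apply RInt_ge_0; trivial.
  - apply (ex_RInt_continuous (V := R_CompleteNormedModule)).
    intros z; rewrite Rmin_left, Rmax_right by lra; apply Hf.
  - intros x Hx; apply Hp; lra.
Qed.

Lemma RInt_mono (f h : R -> R) (a b : R) :
  a <= b -> (forall x, a <= x <= b -> continuous f x) ->
  (forall x, a <= x <= b -> continuous h x) ->
  (forall x, a <= x <= b -> f x <= h x) -> RInt f a b <= RInt h a b.
Proof.
  intros Hab Hf Hh Hle; apply RInt_le; trivial.
  - apply (ex_RInt_continuous (V := R_CompleteNormedModule)).
    intros z; rewrite Rmin_left, Rmax_right by lra; apply Hf.
  - apply (ex_RInt_continuous (V := R_CompleteNormedModule)).
    intros z; rewrite Rmin_left, Rmax_right by lra; apply Hh.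
  - intros x Hx; apply Hle; lra.
Qed.

Lemma RInt_quadratic (f f0 f1 f2 : R -> R) (c a b : R) :
  a <= b ->
  (forall x, a <= x <= b -> continuous f0 x) ->
  (forall x, a <= x <= b -> continuous f1 x) ->
  (forall x, a <= x <= b -> continuous f2 x) ->
  (forall x, a <= x <= b -> f x = f0 x + 2 * c * f1 x + c ^ 2 * f2 x) ->
  RInt f a b = RInt f0 a b + 2 * c * RInt f1 a b + c ^ 2 * RInt f2 a b.
Proof.
  intros Hab H0 H1 H2 H.
  rewrite <- (RInt_add_scal f0 f1 (2 * c)), <- (RInt_add_scal _ f2 (c ^ 2)); trivial.
  - apply RInt_ext_le; trivial.
  - intros x Hx; pose proof (H0 x Hx); pose proof (H1 x Hx); cont.
Qed.

(* [z] stands for [w'] and [w = - (r v)'], so that the pair is divergence free. *)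
Definition divfree_pair (R1 R2 : R) (v w z : R -> R) : Prop :=
  (forall x, R1 <= x <= R2 ->
     is_derive v x (- (v x + w x) / x) /\ is_derive w x (z x) /\ continuous z x)
  /\ v R1 = 0 /\ v R2 = 0 /\ w R2 = 0.

Definition formA (R1 R2 : R) (rho v w v' w' : R -> R) : R :=
  RInt (fun x => rho x * (v x * v' x + w x * w' x) * x) R1 R2.

(* The Dirichlet integral of the velocity divided by [PI]; the factor 3 comes from
   [r v' = - (v + w)], and the boundary term from the slip condition. *)
Definition formE (R1 R2 beta : R) (v w z v' w' z' : R -> R) : R :=
  RInt (fun x => 3 * (v x + w x) * (v' x + w' x) / x + x * z x * z' x) R1 R2
  + beta * w R1 * w' R1.

Definition formB (R1 R2 : R) (G v v' : R -> R) : R :=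
  RInt (fun x => G x * v x * v' x * x) R1 R2.

Lemma divfree_pair_continuous (R1 R2 : R) (v w z : R -> R) :
  divfree_pair R1 R2 v w z ->
  forall x, R1 <= x <= R2 -> continuous v x /\ continuous w x /\ continuous z x.
Proof.
  intros [H _] x Hx; destruct (H x Hx) as [H1 [H2 H3]].
  split; [|split]; trivial; eapply is_derive_continuous; eassumption.
Qed.

Lemma divfree_pair_add (R1 R2 c : R) (v w z v' w' z' : R -> R) :
  0 < R1 -> divfree_pair R1 R2 v w z -> divfree_pair R1 R2 v' w' z' ->
  divfree_pair R1 R2 (fun x => v x + c * v' x) (fun x => w x + c * w' x)
    (fun x => z x + c * z' x).
Proof.
  intros h1 [H [E1 [E2 E3]]] [H' [E1' [E2' E3']]].
  split; [|rewrite E1, E2, E3, E1', E2', E3'; repeat split; ring].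
  intros x Hx; destruct (H x Hx) as [D1 [D2 D3]]; destruct (H' x Hx) as [D1' [D2' D3']].
  split; [|split]; [| |cont].
  - evar_last.
    + apply (is_derive_plus v (fun x => c * v' x)); [eassumption|apply (is_derive_scal v'); eassumption].
    + unfold plus; simpl; field; lra.
  - apply (is_derive_plus w (fun x => c * w' x)); [eassumption|apply (is_derive_scal w'); eassumption].
Qed.


(** The added pair is the first argument of the cross term because the weak form has the solution
    first and the test pair second; the two are matched by rewriting in the coercivity argument. *)
Lemma formA_add (R1 R2 c : R) (rho v w z v' w' z' : R -> R) :
  R1 <= R2 -> (forall x, continuous rho x) ->
  divfree_pair R1 R2 v w z -> divfree_pair R1 R2 v' w' z' ->
  formA R1 R2 rho (fun x => v x + c * v' x) (fun x => w x + c * w' x)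
    (fun x => v x + c * v' x) (fun x => w x + c * w' x)
  = formA R1 R2 rho v w v w + 2 * c * formA R1 R2 rho v' w' v w
    + c ^ 2 * formA R1 R2 rho v' w' v' w'.
Proof.
  intros h12 hrho Hv Hv'.
  assert (C := divfree_pair_continuous _ _ _ _ _ Hv); assert (C' := divfree_pair_continuous _ _ _ _ _ Hv').
  unfold formA; apply RInt_quadratic; trivial;
    try (intros x Hx; destruct (C x Hx) as [? [? ?]]; destruct (C' x Hx) as [? [? ?]]; cont).
  ring.
Qed.

Lemma formB_add (R1 R2 c : R) (G v w z v' w' z' : R -> R) :
  R1 <= R2 -> (forall x, continuous G x) ->
  divfree_pair R1 R2 v w z -> divfree_pair R1 R2 v' w' z' ->
  formB R1 R2 G (fun x => v x + c * v' x) (fun x => v x + c * v' x)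
  = formB R1 R2 G v v + 2 * c * formB R1 R2 G v' v + c ^ 2 * formB R1 R2 G v' v'.
Proof.
  intros h12 hG Hv Hv'.
  assert (C := divfree_pair_continuous _ _ _ _ _ Hv); assert (C' := divfree_pair_continuous _ _ _ _ _ Hv').
  unfold formB; apply RInt_quadratic; trivial;
    try (intros x Hx; destruct (C x Hx) as [? [? ?]]; destruct (C' x Hx) as [? [? ?]]; cont).
  ring.
Qed.

Lemma formE_add (R1 R2 beta c : R) (v w z v' w' z' : R -> R) :
  0 < R1 -> R1 <= R2 ->
  divfree_pair R1 R2 v w z -> divfree_pair R1 R2 v' w' z' ->
  formE R1 R2 beta (fun x => v x + c * v' x) (fun x => w x + c * w' x)
    (fun x => z x + c * z' x)
    (fun x => v x + c * v' x) (fun x => w x + c * w' x) (fun x => z x + c * z' x)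
  = formE R1 R2 beta v w z v w z + 2 * c * formE R1 R2 beta v' w' z' v w z
    + c ^ 2 * formE R1 R2 beta v' w' z' v' w' z'.
Proof.
  intros h1 h12 Hv Hv'.
  assert (C := divfree_pair_continuous _ _ _ _ _ Hv); assert (C' := divfree_pair_continuous _ _ _ _ _ Hv').
  unfold formE.
  rewrite (RInt_quadratic _
    (fun x => 3 * (v x + w x) * (v x + w x) / x + x * z x * z x)
    (fun x => 3 * (v' x + w' x) * (v x + w x) / x + x * z' x * z x)
    (fun x => 3 * (v' x + w' x) * (v' x + w' x) / x + x * z' x * z' x) c); trivial;
    try (intros x Hx; destruct (C x Hx) as [? [? ?]]; destruct (C' x Hx) as [? [? ?]]; cont; lra).
  ring.
Qed.

(** In the application [kappa = 1 / R1 - alpha / mu], so the boundary coefficient [R1 * kappa] of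
    the dissipation is [1 - alpha * R1 / mu]. The values of [Z] and [q] at [R2] stay free; they are
    the shooting parameters. *)
Definition mode_bc (R1 R2 kappa : R) (u W Z : R -> R) : Prop :=
  u R1 = 0 /\ u R2 = 0 /\ W R2 = 0 /\ Z R1 = kappa * W R1.

(** Makes a solution of the mode equations an admissible test pair, so that the weak form can be
    tested with the response itself. *)
Lemma mode_divfree_pair (R1 R2 mu l kappa : R) (rho G F u W Z q : R -> R) :
  mode_ode R1 R2 mu l rho G F u W Z q -> mode_bc R1 R2 kappa u W Z ->
  divfree_pair R1 R2 u W Z.
Proof.
  intros H [E1 [E2 [E3 _]]]; split; [|auto].
  intros x Hx; destruct (H x Hx) as [D1 [D2 [D3 _]]].
  split; [|split]; trivial; eapply is_derive_continuous; eassumption.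
Qed.

(* The pressure drops out because [v] vanishes at both ends and [w = - (r v)'];
   the slip condition supplies the boundary term of [formE]. *)
Lemma mode_weak_form (R1 R2 mu l kappa : R) (rho G F u W Z q v w z : R -> R) :
  0 < R1 -> R1 < R2 -> 0 < mu -> 0 < l ->
  (forall x, continuous rho x) -> (forall x, continuous G x) ->
  (forall x, continuous F x) ->
  mode_ode R1 R2 mu l rho G F u W Z q -> mode_bc R1 R2 kappa u W Z ->
  divfree_pair R1 R2 v w z ->
  l * formA R1 R2 rho u W v w + mu * formE R1 R2 (R1 * kappa) u W Z v w z
    - formB R1 R2 G u v / l
  = RInt (fun x => F x * v x * x) R1 R2.
Proof.
  intros h1 h12 hmu hl hrho hG hF Hode Hbc Hv.
  assert (Cv := divfree_pair_continuous _ _ _ _ _ Hv).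
  assert (Cu := divfree_pair_continuous _ _ _ _ _ (mode_divfree_pair _ _ _ _ _ _ _ _ _ _ _ _ Hode Hbc)).
  destruct Hv as [Hv [Ev1 [Ev2 Ew2]]].
  set (fA := fun x => rho x * (u x * v x + W x * w x) * x).
  set (fE := fun x => 3 * (u x + W x) * (v x + w x) / x + x * Z x * z x).
  set (fB := fun x => G x * u x * v x * x).
  set (fF := fun x => F x * v x * x).
  assert (CA : forall x, R1 <= x <= R2 -> continuous fA x).
  { intros x Hx; destruct (Cv x Hx) as [? [? ?]]; destruct (Cu x Hx) as [? [? ?]]; unfold fA; cont. }
  assert (CE : forall x, R1 <= x <= R2 -> continuous fE x).
  { intros x Hx; destruct (Cv x Hx) as [? [? ?]]; destruct (Cu x Hx) as [? [? ?]]; unfold fE; cont; lra. }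
  assert (CB : forall x, R1 <= x <= R2 -> continuous fB x).
  { intros x Hx; destruct (Cv x Hx) as [? [? ?]]; destruct (Cu x Hx) as [? [? ?]]; unfold fB; cont. }
  assert (CF : forall x, R1 <= x <= R2 -> continuous fF x).
  { intros x Hx; destruct (Cv x Hx) as [? [? ?]]; unfold fF; cont. }
  (* A primitive of the difference of the two sides, up to the boundary term. The pressure cancels
     pointwise: [- (q x v)'] leaves [+ q w] since [(x v)' = - w], while [mu x Z' w] contributes
     [- q w]. At [R2] everything vanishes; at [R1] only [mu R1 Z w] survives. *)
  set (T := fun x => mu * (- (u x + W x) * v x + x * Z x * w x) - q x * x * v x).
  set (dT := fun x => (((- fF x) + l * fA x) + mu * fE x) + (- / l) * fB x).
  assert (HT : is_RInt dT R1 R2 (T R2 - T R1)).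
  { apply (is_RInt_derive T dT); intros x; rewrite Rmin_left, Rmax_right by lra; intros Hx.
    - destruct (Hode x Hx) as [D1 [D2 [D3 D4]]]; destruct (Hv x Hx) as [D5 [D6 _]].
      unfold T; auto_derive.
      + repeat split; eexists; eassumption.
      + erewrite !(is_derive_unique (fun x : R => u x)), !(is_derive_unique (fun x : R => W x)),
          !(is_derive_unique (fun x : R => Z x)), !(is_derive_unique (fun x : R => q x)),
          !(is_derive_unique (fun x : R => v x)), !(is_derive_unique (fun x : R => w x)) by eassumption.
        unfold dT, fF, fA, fE, fB; field; lra.
    - pose proof (CA x Hx); pose proof (CE x Hx); pose proof (CB x Hx); pose proof (CF x Hx).
      unfold dT; cont. }
  apply (is_RInt_unique (V := R_CompleteNormedModule) dT) in HT; unfold dT in HT.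
  rewrite !RInt_add_scal in HT; try lra; try assumption;
    try (intros x Hx; pose proof (CA x Hx); pose proof (CE x Hx); pose proof (CB x Hx); pose proof (CF x Hx); cont).
  assert (EF : RInt (fun x => - fF x) R1 R2 = - RInt fF R1 R2).
  { apply is_RInt_unique, (is_RInt_opp fF R1 R2 (RInt fF R1 R2)).
    apply (RInt_correct (V := R_CompleteNormedModule)), ex_RInt_continuous.
    intros z0; rewrite Rmin_left, Rmax_right by lra; apply CF. }
  rewrite EF in HT; unfold T in HT; rewrite Ev1, Ev2, Ew2 in HT.
  destruct Hbc as [_ [_ [_ EZ]]]; rewrite EZ in HT.
  unfold formA, formE, formB; fold fA fE fB fF.
  unfold Rdiv; lra.
Qed.

Lemma mode_ode_zero (R1 R2 mu l : R) (rho G : R -> R) :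
  0 < R1 -> 0 < mu -> 0 < l ->
  mode_ode R1 R2 mu l rho G (fun _ => 0) (fun _ => 0) (fun _ => 0) (fun _ => 0) (fun _ => 0).
Proof.
  intros h1 hmu hl x Hx.
  split; [|split; [|split]]; (evar_last; [apply is_derive_const|];
    unfold zero; simpl; field; lra).
Qed.

Lemma sqr_sum3_le (a b c : R) : (a + b + c) ^ 2 <= 3 * (a ^ 2 + b ^ 2 + c ^ 2).
Proof.
  pose proof (pow2_ge_0 (a - b)); pose proof (pow2_ge_0 (a - c)); pose proof (pow2_ge_0 (b - c)); nra.
Qed.

Lemma sqr_sum2_le (a b : R) : (a + b) ^ 2 <= 2 * (a ^ 2 + b ^ 2).
Proof. pose proof (pow2_ge_0 (a - b)); nra. Qed.

(* Fredholm alternative: shooting from [R2], where two of the four Cauchy data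
   are prescribed, leaves a 2 x 2 linear system at [R1]. *)
Lemma mode_alternative (R1 R2 mu l kappa : R) (rho G : R -> R) :
  0 < R1 -> R1 < R2 -> 0 < mu -> 0 < l ->
  (forall x, continuous rho x) -> (forall x, continuous G x) ->
  (exists u W Z q, mode_ode R1 R2 mu l rho G (fun _ => 0) u W Z q
     /\ mode_bc R1 R2 kappa u W Z /\ (Z R2 <> 0 \/ q R2 <> 0))
  \/ (exists C, 0 <= C /\ forall F, (forall x, continuous F x) ->
       exists u W Z q, mode_ode R1 R2 mu l rho G F u W Z q
         /\ mode_bc R1 R2 kappa u W Z
         /\ forall x, R1 <= x <= R2 -> u x ^ 2 <= C * RInt (fun s => F s ^ 2) R1 R2).
Proof.
  intros h1 h12 hmu hl hrho hG.
  assert (h0 : forall x : R, continuous (fun _ : R => 0) x) by (intros; apply continuous_const).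
  destruct (mode_ode_exists R1 R2 mu l rho G (fun _ => 0) 0 0 1 0 h1 h12 hmu hl hrho hG h0)
    as [u1 [W1 [Z1 [q1 [O1 [Eu1 [EW1 [EZ1 Eq1]]]]]]]].
  destruct (mode_ode_exists R1 R2 mu l rho G (fun _ => 0) 0 0 0 1 h1 h12 hmu hl hrho hG h0)
    as [u2 [W2 [Z2 [q2 [O2 [Eu2 [EW2 [EZ2 Eq2]]]]]]]].
  set (b1 := Z1 R1 - kappa * W1 R1); set (b2 := Z2 R1 - kappa * W2 R1).
  (* Solutions 1 and 2 span the homogeneous solutions with [u = W = 0] at [R2]; the remaining
     conditions at [R1] are [u = 0] and [Z - kappa * W = 0], and [det] is their determinant on this
     plane. *)
  set (det := u1 R1 * b2 - u2 R1 * b1).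
  destruct (Req_dec det 0) as [Hdet|Hdet].
  - left.
    (* A kernel vector of the singular matrix. Its entries are the values of [Z] and [q] at [R2],
       which is why the nontriviality is expressed there. *)
    assert (Hc : exists c1 c2, (c1 <> 0 \/ c2 <> 0) /\
      c1 * u1 R1 + c2 * u2 R1 = 0 /\ c1 * b1 + c2 * b2 = 0).
    { destruct (Req_dec (u1 R1) 0) as [A1|A1]; [destruct (Req_dec (u2 R1) 0) as [A2|A2]|].
      - destruct (Req_dec b1 0) as [B1|B1]; [exists 1, 0|exists b2, (- b1)];
          repeat split; try lra; rewrite A1, A2; ring.
      - exists (u2 R1), (- u1 R1); repeat split; [lra|ring|unfold det in Hdet; lra].
      - exists (u2 R1), (- u1 R1); repeat split; [lra|ring|unfold det in Hdet; lra]. }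
    destruct Hc as [c1 [c2 [Hc [Hu Hb]]]].
    do 4 eexists; split; [|split].
    + apply (mode_ode_lincomb R1 R2 mu l rho G (fun _ => 0) c1 c2); [trivial|trivial|trivial| |exact O1|exact O2].
      apply mode_ode_zero; trivial.
    + unfold b1, b2 in Hb; unfold mode_bc; cbv beta; rewrite Eu1, Eu2, EW1, EW2; repeat split; lra.
    + cbv beta; rewrite EZ1, EZ2, Eq1, Eq2; lra.
  - right.
    destruct (mode_ode_bound R1 R2 mu l rho G h1 h12 hmu hl hrho hG) as [C0 [HC0 HB]].
    assert (Cont : forall u W Z q, mode_ode R1 R2 mu l rho G (fun _ => 0) u W Z q ->
      forall x, R1 <= x <= R2 -> continuous u x).
    { intros u W Z q O x Hx; destruct (O x Hx) as [D _]; eapply is_derive_continuous; exact D. }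
    destruct (continuous_bounded u1 R1 R2 (Rlt_le _ _ h12) (Cont _ _ _ _ O1)) as [m1 [Hm1 Hb1]].
    destruct (continuous_bounded u2 R1 R2 (Rlt_le _ _ h12) (Cont _ _ _ _ O2)) as [m2 [Hm2 Hb2]].
    assert (Hs1 : forall x, R1 <= x <= R2 -> u1 x ^ 2 <= m1 ^ 2).
    { intros x Hx; rewrite <- pow2_abs; apply pow_incr; split; [apply Rabs_pos|auto]. }
    assert (Hs2 : forall x, R1 <= x <= R2 -> u2 x ^ 2 <= m2 ^ 2).
    { intros x Hx; rewrite <- pow2_abs; apply pow_incr; split; [apply Rabs_pos|auto]. }
    clear Hb1 Hb2.
    set (D := / det).
    (* These constants come from [(a + b)^2 <= 2 (a^2 + b^2)] applied to the Cramer coefficients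
       [c1] and [c2] below, with [u R1 ^ 2 <= J] and [b ^ 2 <= 2 * (1 + kappa ^ 2) * J]. *)
    set (k1 := 2 * D ^ 2 * (b2 ^ 2 + u2 R1 ^ 2 * (2 * (1 + kappa ^ 2)))).
    set (k2 := 2 * D ^ 2 * (u1 R1 ^ 2 * (2 * (1 + kappa ^ 2)) + b1 ^ 2)).
    assert (Hk1 : 0 <= k1).
    { unfold k1; repeat first [apply pow2_ge_0 | apply Rplus_le_le_0_compat | apply Rmult_le_pos | lra]. }
    assert (Hk2 : 0 <= k2).
    { unfold k2; repeat first [apply pow2_ge_0 | apply Rplus_le_le_0_compat | apply Rmult_le_pos | lra]. }
    exists (3 * (1 + k1 * m1 ^ 2 + k2 * m2 ^ 2) * C0); split.
    { repeat first [assumption | apply pow2_ge_0 | apply Rplus_le_le_0_compat | apply Rmult_le_pos | lra]. }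
    intros F HF.
    destruct (mode_ode_exists R1 R2 mu l rho G F 0 0 0 0 h1 h12 hmu hl hrho hG HF)
      as [u [W [Z [q [O [Eu [EW [EZ Eq]]]]]]]].
    specialize (HB F u W Z q HF O Eu EW EZ Eq).
    set (J := C0 * RInt (fun s => F s ^ 2) R1 R2) in HB.
    set (b := Z R1 - kappa * W R1).
    (* Cramer's rule: the correction of the solution with zero Cauchy data at [R2] that restores
       both conditions at [R1]. *)
    set (c1 := D * (- u R1 * b2 + u2 R1 * b)); set (c2 := D * (- u1 R1 * b + b1 * u R1)).
    assert (H1 := HB R1 ltac:(lra)).
    pose proof (pow2_ge_0 (u R1)); pose proof (pow2_ge_0 (W R1)); pose proof (pow2_ge_0 (Z R1));
      pose proof (pow2_ge_0 (q R1)).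
    assert (HJ : 0 <= J) by lra.
    assert (Hu2 : u R1 ^ 2 <= J) by lra.
    assert (Hb2 : b ^ 2 <= 2 * (1 + kappa ^ 2) * J).
    { unfold b; replace (Z R1 - kappa * W R1) with (Z R1 + (- kappa * W R1)) by ring.
      eapply Rle_trans; [apply sqr_sum2_le|].
      replace ((- kappa * W R1) ^ 2) with (kappa ^ 2 * W R1 ^ 2) by ring.
      pose proof (pow2_ge_0 kappa).
      assert (kappa ^ 2 * W R1 ^ 2 <= kappa ^ 2 * J) by (apply Rmult_le_compat_l; lra).
      lra. }
    assert (Hc1 : c1 ^ 2 <= k1 * J).
    { unfold c1, k1; rewrite Rpow_mult_distr, (Rmult_comm 2 (D ^ 2)), !Rmult_assoc.
      apply Rmult_le_compat_l; [apply pow2_ge_0|].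
      eapply Rle_trans; [apply sqr_sum2_le|]; apply Rmult_le_compat_l; [lra|].
      rewrite Rmult_plus_distr_r.
      replace ((- u R1 * b2) ^ 2) with (b2 ^ 2 * u R1 ^ 2) by ring.
      rewrite Rpow_mult_distr, !Rmult_assoc.
      apply Rplus_le_compat; apply Rmult_le_compat_l; try apply pow2_ge_0; lra. }
    assert (Hc2 : c2 ^ 2 <= k2 * J).
    { unfold c2, k2; rewrite Rpow_mult_distr, (Rmult_comm 2 (D ^ 2)), !Rmult_assoc.
      apply Rmult_le_compat_l; [apply pow2_ge_0|].
      eapply Rle_trans; [apply sqr_sum2_le|]; apply Rmult_le_compat_l; [lra|].
      rewrite Rmult_plus_distr_r.
      replace ((- u1 R1 * b) ^ 2) with (u1 R1 ^ 2 * b ^ 2) by ring.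
      rewrite Rpow_mult_distr, !Rmult_assoc.
      apply Rplus_le_compat; apply Rmult_le_compat_l; try apply pow2_ge_0; lra. }
    do 4 eexists; split; [|split].
    + apply (mode_ode_lincomb R1 R2 mu l rho G F c1 c2);
        [trivial|trivial|trivial|exact O|exact O1|exact O2].
    + unfold mode_bc; cbv beta; rewrite Eu, EW, Eu1, Eu2, EW1, EW2; repeat split; try ring.
      * unfold c1, c2, D, det; field; exact Hdet.
      * assert (E : b + c1 * b1 + c2 * b2 = 0).
        { unfold c1, c2, D, det; field; exact Hdet. }
        unfold b, b1, b2 in E; lra.
    + intros x Hx; cbv beta.
      eapply Rle_trans; [apply sqr_sum3_le|].
      rewrite !Rpow_mult_distr.
      replace (_ * RInt _ _ _) with (3 * (J + k1 * J * m1 ^ 2 + k2 * J * m2 ^ 2)) by (unfold J; ring).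
      apply Rmult_le_compat_l; [lra|]; apply Rplus_le_compat; [apply Rplus_le_compat|].
      * specialize (HB x Hx).
        pose proof (pow2_ge_0 (W x)); pose proof (pow2_ge_0 (Z x)); pose proof (pow2_ge_0 (q x)); lra.
      * apply Rmult_le_compat; auto using pow2_ge_0.
      * apply Rmult_le_compat; auto using pow2_ge_0.
Qed.

(** * Bounds of the three forms by the weighted L2 norm *)

(** [formB] with weight 1 is [int v^2 r], the norm in which all estimates are made; the azimuthal
    part of the kinetic energy is dropped. *)
Lemma formA_ge (R1 R2 m0 : R) (rho v w z : R -> R) :
  0 < R1 -> R1 <= R2 -> (forall x, continuous rho x) -> 0 <= m0 ->
  (forall x, R1 <= x <= R2 -> m0 <= rho x) -> divfree_pair R1 R2 v w z ->
  m0 * formB R1 R2 (fun _ => 1) v v <= formA R1 R2 rho v w v w.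
Proof.
  intros h1 h12 hrho hm hle Hv.
  assert (Cv := divfree_pair_continuous _ _ _ _ _ Hv).
  unfold formA, formB.
  replace (m0 * _) with (RInt (fun _ => 0) R1 R2 + m0 * RInt (fun x => 1 * v x * v x * x) R1 R2)
    by (rewrite (RInt_const (V := R_CompleteNormedModule)); unfold scal; simpl; unfold mult; simpl; ring).
  rewrite <- RInt_add_scal; trivial;
    try (intros x Hx; destruct (Cv x Hx) as [? [? ?]]; cont).
  apply RInt_mono; trivial; try (intros x Hx; destruct (Cv x Hx) as [? [? ?]]; cont).
  specialize (hle x Hx).
  pose proof (pow2_ge_0 (v x)); pose proof (pow2_ge_0 (w x)).
  replace (0 + m0 * (1 * v x * v x * x)) with (m0 * v x ^ 2 * x) by ring.
  apply Rmult_le_compat_r; [lra|].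
  apply Rle_trans with (m0 * (v x * v x + w x * w x)); [nra|].
  apply Rmult_le_compat_r; nra.
Qed.

Lemma formB_ge_0 (R1 R2 : R) (v w z : R -> R) :
  0 < R1 -> R1 <= R2 -> divfree_pair R1 R2 v w z ->
  0 <= formB R1 R2 (fun _ => 1) v v.
Proof.
  intros h1 h12 Hv; assert (Cv := divfree_pair_continuous _ _ _ _ _ Hv).
  unfold formB; apply RInt_nonneg; trivial; intros x Hx; destruct (Cv x Hx) as [? [? ?]]; [cont|].
  pose proof (pow2_ge_0 (v x)); apply Rmult_le_pos; nra.
Qed.

Lemma formE_ge_0 (R1 R2 beta : R) (v w z : R -> R) :
  0 < R1 -> R1 <= R2 -> 0 <= beta -> divfree_pair R1 R2 v w z ->
  0 <= formE R1 R2 beta v w z v w z.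
Proof.
  intros h1 h12 hb Hv; assert (Cv := divfree_pair_continuous _ _ _ _ _ Hv).
  unfold formE; apply Rplus_le_le_0_compat.
  - apply RInt_nonneg; trivial; intros x Hx; destruct (Cv x Hx) as [? [? ?]]; [cont; lra|].
    apply Rplus_le_le_0_compat.
    + apply Rdiv_le_0_compat; [|lra]; pose proof (pow2_ge_0 (v x + w x)); nra.
    + rewrite Rmult_assoc; apply Rmult_le_pos; [lra|]; pose proof (pow2_ge_0 (z x)); nra.
  - rewrite Rmult_assoc; apply Rmult_le_pos; [trivial|]; pose proof (pow2_ge_0 (w R1)); nra.
Qed.

Lemma formB_le (R1 R2 M : R) (G v w z : R -> R) :
  0 < R1 -> R1 <= R2 -> (forall x, continuous G x) ->
  (forall x, R1 <= x <= R2 -> Rabs (G x) <= M) -> divfree_pair R1 R2 v w z ->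
  formB R1 R2 G v v <= M * formB R1 R2 (fun _ => 1) v v.
Proof.
  intros h1 h12 hG hM Hv; assert (Cv := divfree_pair_continuous _ _ _ _ _ Hv).
  unfold formB.
  replace (M * _) with (RInt (fun _ => 0) R1 R2 + M * RInt (fun x => 1 * v x * v x * x) R1 R2)
    by (rewrite (RInt_const (V := R_CompleteNormedModule)); unfold scal; simpl; unfold mult; simpl; ring).
  rewrite <- RInt_add_scal; trivial; try (intros x Hx; destruct (Cv x Hx) as [? [? ?]]; cont).
  apply RInt_mono; trivial; try (intros x Hx; destruct (Cv x Hx) as [? [? ?]]; cont).
  specialize (hM x Hx); apply Rabs_le_between in hM.
  pose proof (pow2_ge_0 (v x)).
  replace (G x * v x * v x * x) with (G x * v x ^ 2 * x) by ring.
  replace (0 + M * (1 * v x * v x * x)) with (M * v x ^ 2 * x) by ring.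
  apply Rmult_le_compat_r; [lra|]; apply Rmult_le_compat_r; lra.
Qed.

(** This is [l] times the left side of the weak form on the diagonal. The factor removes the
    division by [l] and makes the form polynomial in the rate. *)
Definition growth_form (R1 R2 mu beta : R) (rho G : R -> R) (l : R) (v w z : R -> R) : R :=
  l ^ 2 * formA R1 R2 rho v w v w + l * mu * formE R1 R2 beta v w z v w z
  - formB R1 R2 G v v.

(** * The critical growth rate *)

(* Testing nonnegativity with [v - psi / K], where [psi] solves the mode
   equations with forcing [v], bounds the form from below without compactness. *)
Lemma growth_form_coercive (R1 R2 mu l kappa C : R) (rho G : R -> R) :
  0 < R1 -> R1 < R2 -> 0 < mu -> 0 < l ->
  (forall x, continuous rho x) -> (forall x, continuous G x) -> 0 <= C ->
  (forall F, (forall x, continuous F x) ->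
     exists u W Z q, mode_ode R1 R2 mu l rho G F u W Z q
       /\ mode_bc R1 R2 kappa u W Z
       /\ forall x, R1 <= x <= R2 -> u x ^ 2 <= C * RInt (fun s => F s ^ 2) R1 R2) ->
  (forall v w z, divfree_pair R1 R2 v w z ->
     0 <= growth_form R1 R2 mu (R1 * kappa) rho G l v w z) ->
  exists c, 0 < c /\ forall v w z, divfree_pair R1 R2 v w z ->
    c * formB R1 R2 (fun _ => 1) v v <= growth_form R1 R2 mu (R1 * kappa) rho G l v w z.
Proof.
  intros h1 h12 hmu hl hrho hG hC Hsolve Hpos.
  (* Chosen so that [int F u r <= K * int v^2 r]: the term 1/2 comes from [2 u v <= u^2 + v^2], the
     other one from [u^2 <= C * int F^2], integrated over length [R2 - R1] with [r <= R2], and from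
     [R1 * int F^2 <= int v^2 r]. *)
  set (K := / 2 + (R2 - R1) * R2 * C / (2 * R1)).
  assert (HK : 0 < K).
  { unfold K; apply Rplus_lt_le_0_compat; [lra|].
    apply Rdiv_le_0_compat; [|lra]; repeat apply Rmult_le_pos; lra. }
  exists (l / K); split; [apply Rdiv_lt_0_compat; trivial|].
  intros v w z Hv.
  assert (Cv := divfree_pair_continuous _ _ _ _ _ Hv).
  set (F := fun x => v (clamp R1 R2 x)).
  assert (HF : forall x, continuous F x).
  { intros x; apply continuous_comp_clamp; [lra|]; intros y Hy; apply Cv; trivial. }
  destruct (Hsolve F HF) as [u [W [Z [q [Hode [Hbc Hu]]]]]].
  assert (Hpsi := mode_divfree_pair _ _ _ _ _ _ _ _ _ _ _ _ Hode Hbc).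
  assert (Cu := divfree_pair_continuous _ _ _ _ _ Hpsi).
  set (N := formB R1 R2 (fun _ => 1) v v).
  assert (E1 : RInt (fun x => F x * v x * x) R1 R2 = N).
  { apply RInt_ext_le; [lra|]; intros x Hx; unfold F; rewrite clamp_id by trivial; ring. }
  set (I := RInt (fun s => F s ^ 2) R1 R2).
  fold I in Hu.
  assert (CF2 : forall x, R1 <= x <= R2 -> continuous (fun s => F s ^ 2) x) by (intros; cont).
  assert (HI : 0 <= I).
  { apply RInt_nonneg; [lra|trivial|intros; apply pow2_ge_0]. }
  assert (HIN : R1 * I <= N).
  { unfold N, formB, I.
    replace (R1 * _) with (RInt (fun _ => 0) R1 R2 + R1 * RInt (fun s => F s ^ 2) R1 R2)
      by (rewrite (RInt_const (V := R_CompleteNormedModule)); unfold scal; simpl; unfold mult; simpl; ring).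
    rewrite <- RInt_add_scal; [|lra|intros; apply continuous_const|trivial].
    apply RInt_mono; [lra|intros; cont|intros x Hx; destruct (Cv x Hx) as [? _]; cont|].
    intros x Hx; unfold F; rewrite clamp_id by trivial; pose proof (pow2_ge_0 (v x)).
    replace (1 * v x * v x * x) with (x * v x ^ 2) by ring.
    rewrite Rplus_0_l; apply Rmult_le_compat_r; lra. }
  assert (E2 : RInt (fun x => F x * u x * x) R1 R2 <= K * N).
  { apply Rle_trans with (RInt (fun x => (R2 * C * I / 2) + / 2 * (1 * v x * v x * x)) R1 R2).
    - apply RInt_mono; [lra| | |].
      + intros x Hx; destruct (Cu x Hx) as [? _]; cont.
      + intros x Hx; destruct (Cv x Hx) as [? _]; cont.
      + intros x Hx; unfold F; rewrite clamp_id by trivial.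
        specialize (Hu x Hx); pose proof (pow2_ge_0 (v x - u x)).
        assert (x * u x ^ 2 <= R2 * (C * I)).
        { apply Rmult_le_compat; try lra; apply pow2_ge_0. }
        assert (0 <= x * (v x - u x) ^ 2) by (apply Rmult_le_pos; lra).
        nra.
    - rewrite RInt_add_scal; [|lra|intros; apply continuous_const|
        intros x Hx; destruct (Cv x Hx) as [? _]; cont].
      change (RInt (fun x => 1 * v x * v x * x) R1 R2) with N.
      rewrite (RInt_const (V := R_CompleteNormedModule)); unfold scal; simpl; unfold mult; simpl.
      unfold K; rewrite Rmult_plus_distr_r.
      assert ((R2 - R1) * R2 * C / (2 * R1) * (R1 * I) <= (R2 - R1) * R2 * C / (2 * R1) * N).
      { apply Rmult_le_compat_l; [|trivial].
        apply Rdiv_le_0_compat; [|lra]; repeat apply Rmult_le_pos; lra. }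
      replace ((R2 - R1) * R2 * C / (2 * R1) * (R1 * I)) with ((R2 - R1) * (R2 * C * I / 2)) in H by (field; lra).
      lra. }
  assert (W1 := mode_weak_form _ _ _ _ _ _ _ _ _ _ _ _ _ _ _ h1 h12 hmu hl hrho hG HF Hode Hbc Hv).
  assert (W2 := mode_weak_form _ _ _ _ _ _ _ _ _ _ _ _ _ _ _ h1 h12 hmu hl hrho hG HF Hode Hbc Hpsi).
  rewrite E1 in W1.
  (* This value minimises [2 c l N + c^2 l K N], an upper bound for what the test adds to the form;
     the minimum is [- (l / K) * N]. *)
  set (c := - / K).
  specialize (Hpos _ _ _ (divfree_pair_add R1 R2 c v w z u W Z h1 Hv Hpsi)).
  unfold growth_form in *.
  rewrite (formA_add R1 R2 c rho v w z u W Z), (formB_add R1 R2 c G v w z u W Z),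
    (formE_add R1 R2 (R1 * kappa) c v w z u W Z) in Hpos by (trivial; lra).
  set (X := RInt (fun x => F x * u x * x) R1 R2) in *.
  match goal with |- _ <= ?q =>
    assert (E : 0 <= q + 2 * c * (l * N) + c ^ 2 * (l * X)) end.
  { rewrite <- W1, <- W2; eapply Rle_trans; [exact Hpos|right]; field; lra. }
  assert (c ^ 2 * (l * X) <= c ^ 2 * (l * (K * N))).
  { apply Rmult_le_compat_l; [apply pow2_ge_0|apply Rmult_le_compat_l; lra]. }
  assert (Ec : c ^ 2 * (l * (K * N)) = l / K * N) by (unfold c; field; lra).
  assert (Ec2 : 2 * c * (l * N) = - 2 * (l / K * N)) by (unfold c; field; lra).
  fold N in E |- *; lra.
Qed.

Lemma exists_nontrivial_mode (R1 R2 mu kappa m0 : R) (rho G v0 w0 z0 : R -> R) :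
  0 < R1 -> R1 < R2 -> 0 < mu -> 0 <= kappa ->
  (forall x, continuous rho x) -> (forall x, continuous G x) ->
  0 < m0 -> (forall x, R1 <= x <= R2 -> m0 <= rho x) ->
  divfree_pair R1 R2 v0 w0 z0 -> 0 < formB R1 R2 G v0 v0 ->
  exists l u W Z q, 0 < l /\ mode_ode R1 R2 mu l rho G (fun _ => 0) u W Z q
    /\ mode_bc R1 R2 kappa u W Z /\ (Z R2 <> 0 \/ q R2 <> 0).
Proof.
  intros h1 h12 hmu hk hrho hG hm0 hrm Hv0 HB0.
  assert (hbeta : 0 <= R1 * kappa) by (apply Rmult_le_pos; lra).
  assert (h12' : R1 <= R2) by lra.
  destruct (continuous_bounded G R1 R2 h12' (fun x _ => hG x)) as [M0 [HM0 HM0']].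
  set (M := M0 + 1).
  assert (HMG : forall x, R1 <= x <= R2 -> Rabs (G x) <= M).
  { intros x Hx; specialize (HM0' x Hx); unfold M; lra. }
  assert (HM : 0 < M) by (unfold M; lra).
  clearbody M; clear M0 HM0 HM0'.
  set (P := growth_form R1 R2 mu (R1 * kappa) rho G).
  set (A := fun v w : R -> R => formA R1 R2 rho v w v w).
  set (E := fun v w z : R -> R => formE R1 R2 (R1 * kappa) v w z v w z).
  set (B := fun v : R -> R => formB R1 R2 G v v).
  set (N := fun v : R -> R => formB R1 R2 (fun _ => 1) v v).
  assert (PE : forall l v w z, P l v w z = l ^ 2 * A v w + l * mu * E v w z - B v) by reflexivity.
  assert (HN : forall v w z, divfree_pair R1 R2 v w z -> 0 <= N v).
  { intros v w z Hv; apply (formB_ge_0 R1 R2 v w z); trivial. }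
  assert (HA : forall v w z, divfree_pair R1 R2 v w z -> m0 * N v <= A v w).
  { intros v w z Hv; apply (formA_ge R1 R2 m0 rho v w z); trivial; lra. }
  assert (HA0 : forall v w z, divfree_pair R1 R2 v w z -> 0 <= A v w).
  { intros v w z Hv; eapply Rle_trans; [|apply (HA _ _ _ Hv)].
    apply Rmult_le_pos; [lra|apply (HN _ _ _ Hv)]. }
  assert (HE : forall v w z, divfree_pair R1 R2 v w z -> 0 <= mu * E v w z).
  { intros v w z Hv; apply Rmult_le_pos; [left; exact hmu|].
    unfold E; apply formE_ge_0; trivial. }
  assert (HB : forall v w z, divfree_pair R1 R2 v w z -> B v <= M * N v).
  { intros v w z Hv; apply (formB_le R1 R2 M G v w z); trivial. }
  assert (HB0' : 0 < B v0) by exact HB0.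
  assert (EN : forall v, formB R1 R2 (fun _ => 1) v v = N v) by reflexivity.
  (* From here on only the inequalities between these four quantities and the polynomial identity
     [PE] are used. *)
  clearbody A E B N.
  set (S := fun l => 0 < l /\ exists v w z, divfree_pair R1 R2 v w z /\ P l v w z < 0).
  assert (Hbd : bound S).
  (* Beyond this rate [l ^ 2 >= M / m0], so [l ^ 2 * A >= M * N >= B] and the form cannot be
     negative. *)
  { exists (1 + M / m0); intros l [Hl [v [w [z [Hv Hneg]]]]].
    rewrite PE in Hneg.
    pose proof (HN _ _ _ Hv); pose proof (HA _ _ _ Hv); pose proof (HE _ _ _ Hv); pose proof (HB _ _ _ Hv).
    destruct (Rle_lt_dec l (1 + M / m0)) as [|Hlt]; trivial; exfalso.
    assert (0 < M / m0) by (apply Rdiv_lt_0_compat; trivial).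
    assert (M / m0 <= l ^ 2) by nra.
    assert (M <= l ^ 2 * m0).
    { replace M with (M / m0 * m0) by (field; lra); apply Rmult_le_compat_r; lra. }
    assert (M * N v <= l ^ 2 * m0 * N v) by (apply Rmult_le_compat_r; trivial).
    assert (l ^ 2 * (m0 * N v) <= l ^ 2 * A v w) by (apply Rmult_le_compat_l; [apply pow2_ge_0|trivial]).
    assert (0 <= l * (mu * E v w z)) by (apply Rmult_le_pos; lra).
    lra. }
  assert (Hne : exists l, S l).
  (* With [l = B / s] one has [l <= 1], hence [l ^ 2 * A + l * mu * E <= l * (A + mu * E) < l * s =
     B]. *)
  {    set (s := A v0 w0 + mu * E v0 w0 z0 + B v0 + 1).
    pose proof (HA0 _ _ _ Hv0); pose proof (HE _ _ _ Hv0).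
    exists (B v0 / s).
    assert (0 < B v0 / s) by (apply Rdiv_lt_0_compat; unfold s; lra).
    assert (Hs : B v0 = B v0 / s * s) by (field; unfold s; lra).
    assert (B v0 / s <= 1).
    { apply Rmult_le_reg_r with s; [unfold s; lra|]; rewrite <- Hs; unfold s; lra. }
    split; trivial; exists v0, w0, z0; split; trivial.
    rewrite PE; set (l := B v0 / s) in *; unfold s in Hs.
    assert (l ^ 2 * A v0 w0 <= l * A v0 w0) by (apply Rmult_le_compat_r; nra).
    nra. }
  destruct (completeness S Hbd Hne) as [l [Hub Hlub]].
  assert (Hl : 0 < l).
  { destruct Hne as [l0 Hl0]; pose proof (Hub l0 Hl0); destruct Hl0; lra. }
  assert (Hpos : forall v w z, divfree_pair R1 R2 v w z -> 0 <= P l v w z).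
  { intros v w z Hv; destruct (Rle_lt_dec 0 (P l v w z)) as [|Hneg]; trivial; exfalso.
    pose proof (HA0 _ _ _ Hv); pose proof (HE _ _ _ Hv).
    (* A negative value at [l] would persist at [l + d]: since [d <= 1] and [d * s = - P l], the
       expansion in [d] gives [P (l + d) <= d * (P l - 1) < 0], against the upper bound property. *)
    set (s := 2 * l * A v w + mu * E v w z + A v w - P l v w z + 1).
    assert (Hs0 : 0 < s).
    { assert (0 <= 2 * l * A v w) by (apply Rmult_le_pos; lra). unfold s; lra. }
    set (d := - P l v w z / s).
    assert (Hd : 0 < d) by (apply Rdiv_lt_0_compat; lra).
    assert (Hs : - P l v w z = d * s) by (unfold d; field; lra).
    assert (Hd1 : d <= 1).
    { apply Rmult_le_reg_r with s; [trivial|]; rewrite <- Hs; unfold s.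
      assert (0 <= 2 * l * A v w) by (apply Rmult_le_pos; lra). lra. }
    assert (HS : S (l + d)).
    { split; [lra|]; exists v, w, z; split; trivial.
      assert (EP : P (l + d) v w z = P l v w z + d * (2 * l * A v w + mu * E v w z) + d ^ 2 * A v w)
        by (rewrite !PE; ring).
      assert (d ^ 2 * A v w <= d * A v w) by (apply Rmult_le_compat_r; nra).
      assert (0 < d * (- P l v w z + 1)) by (apply Rmult_lt_0_compat; lra).
      unfold s in Hs; rewrite EP; nra. }
    specialize (Hub _ HS); lra. }
  destruct (mode_alternative R1 R2 mu l kappa rho G h1 h12 hmu Hl hrho hG)
    as [[u [W [Z [q [H1 [H2 H3]]]]]]|[C [HC Hsolve]]].
  - exists l, u, W, Z, q; auto.
  - exfalso.
    destruct (growth_form_coercive R1 R2 mu l kappa C rho G) as [c [Hc Hco]]; trivial.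
    (* The choice makes [(1 - 2 * e) * (c + M) = M], so [t > 1 - e] forces [t ^ 2 * (c + M) >= M],
       which is exactly what the final estimate consumes. *)
    set (e := c / (2 * (c + M))).
    assert (He : 0 < e) by (apply Rdiv_lt_0_compat; lra).
    assert (Ee : e * (c + M) = c / 2) by (unfold e; field; lra).
    assert (He2 : e < / 2).
    { apply Rmult_lt_reg_r with (c + M); [lra|]; rewrite Ee; lra. }
    assert (Hl' : exists l', S l' /\ (1 - e) * l < l').
    { apply NNPP; intros Hno; apply (Rlt_irrefl l).
      apply Rle_lt_trans with ((1 - e) * l); [|nra].
      apply Hlub; intros l' Hl'; destruct (Rle_lt_dec l' ((1 - e) * l)) as [|Hlt]; trivial.
      exfalso; apply Hno; exists l'; auto. }
    destruct Hl' as [l' [HS Hlt]]; pose proof (Hub _ HS) as Hle.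
    destruct HS as [Hl'0 [v [w [z [Hv Hneg]]]]].
    pose proof (HN _ _ _ Hv); pose proof (HA0 _ _ _ Hv); pose proof (HE _ _ _ Hv);
      pose proof (HB _ _ _ Hv).
    assert (Hcv : c * N v <= P l v w z) by (rewrite <- EN; apply Hco; trivial).
    set (t := l' / l).
    assert (El : l' = t * l) by (unfold t; field; lra).
    assert (Ht : 1 - e < t) by (apply Rmult_lt_reg_r with l; lra).
    assert (Ht1 : t <= 1) by (apply Rmult_le_reg_r with l; lra).
    assert (Ht2 : 1 - 2 * e <= t ^ 2) by nra.
    (* Only the dissipation fails to scale like [t ^ 2], and since it is nonnegative and [t <= 1]
       this helps. With coercivity and [B <= M * N], the left side is at least
       [(t ^ 2 * (c + M) - M) * N >= 0], contradicting [Hneg]. *)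
    assert (H3 : t ^ 2 * (P l v w z + B v) - B v <= P l' v w z).
    { rewrite !PE, El.
      assert (t ^ 2 * (l * (mu * E v w z)) <= t * (l * (mu * E v w z))).
      { apply Rmult_le_compat_r; [apply Rmult_le_pos; lra|nra]. }
      lra. }
    assert (H4 : t ^ 2 * (c * N v) <= t ^ 2 * P l v w z) by (apply Rmult_le_compat_l; [apply pow2_ge_0|trivial]).
    assert (H5 : (1 - t ^ 2) * B v <= (1 - t ^ 2) * (M * N v)) by (apply Rmult_le_compat_l; [nra|trivial]).
    assert (H6 : (1 - 2 * e) * (c + M) <= t ^ 2 * (c + M)) by (apply Rmult_le_compat_r; lra).
    assert (H7 : M * N v <= t ^ 2 * (c + M) * N v) by (apply Rmult_le_compat_r; [trivial|lra]).
    lra.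
Qed.

(** * A test pair concentrated where the density increases *)

Definition pos_part (t : R) : R := Rmax 0 t.

Lemma continuous_pos_part (t : R) : continuous pos_part t.
Proof.
  apply filterlim_locally; intros eps; exists eps; intros y Hy.
  apply Rle_lt_trans with (Rabs (y - t)); [|exact Hy].
  change (Rabs (pos_part y - pos_part t) <= Rabs (y - t)).
  unfold pos_part, Rmax, Rabs; repeat destruct Rle_dec; repeat destruct Rcase_abs; lra.
Qed.

(** The first-order Taylor remainder is at most [h ^ 2] for every [t], the kink included, so
    [delta = eps] works. *)
Lemma is_derive_pos_part_sqr (t : R) :
  is_derive (fun y => pos_part y ^ 2) t (2 * pos_part t).
Proof.
  apply is_derive_Reals; intros eps Heps; exists (mkposreal eps Heps); simpl.
  intros h Hh Hlt.
  assert (H : Rabs (pos_part (t + h) ^ 2 - pos_part t ^ 2 - 2 * pos_part t * h) <= h ^ 2).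
  { apply Rabs_le; unfold pos_part, Rmax; repeat destruct Rle_dec; split; nra. }
  replace (_ - _) with ((pos_part (t + h) ^ 2 - pos_part t ^ 2 - 2 * pos_part t * h) / h) by (field; trivial).
  unfold Rdiv; rewrite Rabs_mult, Rabs_inv.
  assert (0 < Rabs h) by (apply Rabs_pos_lt; trivial).
  apply Rle_lt_trans with (2 := Hlt).
  apply Rmult_le_reg_r with (Rabs h); trivial.
  rewrite Rmult_assoc, Rinv_l, Rmult_1_r by lra.
  replace (Rabs h * Rabs h) with (h ^ 2); trivial.
  rewrite <- pow2_abs; ring.
Qed.

Lemma pos_part_mul (t : R) : t * pos_part t = pos_part t ^ 2.
Proof. unfold pos_part, Rmax; destruct Rle_dec; simpl; nra. Qed.

(** [v] is the cube of the positive part of [(x - a) * (b - x)]. A cube is needed because the third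
    component involves [v''], which has to be continuous. It is written [Q * p ^ 2], so that only
    the derivative of a squared positive part is used; [Q * p = p ^ 2] tidies the result. *)
Lemma exists_bump_pair (R1 R2 a b : R) :
  0 < R1 -> R1 < a -> a < b -> b < R2 ->
  exists v w z, divfree_pair R1 R2 v w z
    /\ (forall x, a < x < b -> 0 < v x)
    /\ (forall x, R1 <= x <= R2 -> ~ a < x < b -> v x = 0).
Proof.
  intros h1 ha hab hb.
  set (Q := fun x => (x - a) * (b - x)).
  set (p := fun x => pos_part (Q x)).
  set (v := fun x => Q x * p x ^ 2).
  set (v' := fun x => 3 * (a + b - 2 * x) * p x ^ 2).
  set (v'' := fun x => - 6 * p x ^ 2 + 6 * (a + b - 2 * x) ^ 2 * p x).
  assert (Hout : forall x, ~ a < x < b -> p x = 0).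
  { intros x Hx; unfold p, pos_part; apply Rmax_left; unfold Q.
    destruct (Rle_lt_dec x a); [nra|]; destruct (Rle_lt_dec b x); [nra|tauto]. }
  assert (Cp : forall x, continuous p x).
  { intros x; apply (continuous_comp Q pos_part); [unfold Q; cont|apply continuous_pos_part]. }
  assert (DQ : forall x, is_derive Q x (a + b - 2 * x)).
  { intros x; unfold Q; auto_derive; trivial; ring. }
  assert (Dp2 : forall x, is_derive (fun y => p y ^ 2) x (2 * p x * (a + b - 2 * x))).
  { intros x; unfold p; evar_last.
    - apply (is_derive_comp (fun y => pos_part y ^ 2) Q); [apply is_derive_pos_part_sqr|apply DQ].
    - unfold scal; simpl; unfold mult; simpl; ring. }
  assert (EQ : forall x, Q x * p x = p x ^ 2) by (intros x; apply pos_part_mul).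
  assert (Dv : forall x, is_derive v x (v' x)).
  { intros x; unfold v; evar_last.
    - apply (is_derive_mult Q (fun y => p y ^ 2)); [apply DQ|apply Dp2|apply Rmult_comm].
    - unfold plus, mult; simpl; unfold mult; simpl.
      change ((a + b - 2 * x) * p x ^ 2 + Q x * (2 * p x * (a + b - 2 * x)) = v' x).
      unfold v'; replace (Q x * (2 * p x * (a + b - 2 * x)))
        with (2 * (a + b - 2 * x) * (Q x * p x)) by ring.
      rewrite EQ; ring. }
  assert (Dv' : forall x, is_derive v' x (v'' x)).
  { intros x; unfold v'; evar_last.
    - apply (is_derive_mult (fun x => 3 * (a + b - 2 * x)) (fun y => p y ^ 2) x (- 6));
        [auto_derive; trivial; ring|apply Dp2|apply Rmult_comm].
    - unfold plus, mult; simpl; unfold v''; ring. }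
  exists v, (fun x => - (v x + x * v' x)), (fun x => - (2 * v' x + x * v'' x)).
  split; [split|split].
  - intros x Hx; split; [|split].
    + evar_last; [apply Dv|]; field; lra.
    + pose proof (Dv x); pose proof (Dv' x).
      auto_derive; [repeat split; eexists; eassumption|].
      erewrite !(is_derive_unique (fun x : R => v x)), !(is_derive_unique (fun x : R => v' x)) by eassumption.
      ring.
    + unfold v', v''; cont.
  - unfold v, v'; rewrite !Hout by lra; repeat split; ring.
  - intros x Hx; unfold v.
    assert (0 < Q x) by (unfold Q; apply Rmult_lt_0_compat; lra).
    apply Rmult_lt_0_compat; trivial; apply pow_lt.
    unfold p, pos_part; rewrite Rmax_right; lra.
  - intros x _ Hx; unfold v; rewrite Hout by trivial; ring.
Qed.

Lemma exists_pair_formB_pos (R1 R2 rs : R) (G : R -> R) :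
  0 < R1 -> R1 < rs < R2 -> (forall x, continuous G x) -> 0 < G rs ->
  exists v w z, divfree_pair R1 R2 v w z /\ 0 < formB R1 R2 G v v.
Proof.
  intros h1 hrs hG hpos.
  assert (Hloc : locally rs (fun x => 0 < G x)).
  { apply (hG rs); exact (open_gt 0 (G rs) hpos). }
  destruct Hloc as [d Hd].
  (* The halves keep the support strictly inside [(R1, R2)] and inside the ball on which [G] is
     positive. *)
  set (e := Rmin (d / 2) (Rmin ((rs - R1) / 2) ((R2 - rs) / 2))).
  assert (He : 0 < e /\ e < d /\ e < rs - R1 /\ e < R2 - rs).
  { destruct d as [d Hdp]; unfold e, Rmin; simpl; repeat destruct Rle_dec; lra. }
  destruct He as [He [He1 [He2 He3]]].
  destruct (exists_bump_pair R1 R2 (rs - e) (rs + e)) as [v [w [z [Hv [Hin Hout]]]]]; try lra.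
  exists v, w, z; split; trivial.
  assert (Cv := divfree_pair_continuous _ _ _ _ _ Hv).
  assert (CB : forall x, R1 <= x <= R2 -> continuous (fun x => G x * v x * v x * x) x).
  { intros x Hx; destruct (Cv x Hx) as [? _]; cont. }
  assert (HI : forall a b, R1 <= a -> a <= b -> b <= R2 -> ex_RInt (fun x => G x * v x * v x * x) a b).
  { intros a b Ha Hab Hb; apply (ex_RInt_continuous (V := R_CompleteNormedModule)).
    intros x; rewrite Rmin_left, Rmax_right by lra; intros Hx; apply CB; lra. }
  unfold formB.
  rewrite <- (RInt_Chasles (V := R_CompleteNormedModule) _ R1 (rs - e) R2) by (apply HI; lra).
  rewrite <- (RInt_Chasles (V := R_CompleteNormedModule) _ (rs - e) (rs + e) R2) by (apply HI; lra).
  assert (H0 : forall a b, a <= b -> (forall x, a < x < b -> R1 <= x <= R2 /\ ~ rs - e < x < rs + e) ->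
    RInt (fun x => G x * v x * v x * x) a b = 0).
  { intros a b Hab H; rewrite (RInt_ext _ (fun _ => 0)).
    - rewrite (RInt_const (V := R_CompleteNormedModule)); unfold scal; simpl; unfold mult; simpl; ring.
    - intros x; rewrite Rmin_left, Rmax_right by lra; intros Hx.
      destruct (H x Hx); rewrite Hout by trivial; change (G x * 0 * 0 * x = 0); ring. }
  rewrite (H0 R1), (H0 (rs + e)) by (try intros x Hx; lra).
  unfold plus; simpl; rewrite Rplus_0_l, Rplus_0_r.
  apply RInt_gt_0; [lra| |].
  - intros x Hx; assert (0 < G x).
    { apply Hd; apply Rabs_lt_between'; lra. }
    pose proof (Hin x Hx); repeat apply Rmult_lt_0_compat; lra.
  - intros x Hx; apply CB; lra.
Qed.

(** * One-sided derivatives and modes as fields *)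

(** [filterdiff] quantifies over all limits of the filter. Since [S x] holds, the trace filter is
    proper, so [x] is its only limit and one epsilon-delta statement suffices. *)
Lemma is_derive_on_spec (S : R -> Prop) (f : R -> R) (x l : R) :
  S x ->
  is_derive_on S f x l <->
  (forall eps : posreal, exists d : posreal, forall y, S y -> Rabs (y - x) < d ->
     Rabs (f y - f x - (y - x) * l) <= eps * Rabs (y - x)).
Proof.
  intros Sx; split.
  - intros [_ H] eps.
    assert (Hx : is_filter_lim (within S (locally x)) x) by (apply filter_le_within).
    destruct (H x Hx eps) as [d Hd]; exists d; intros y Sy Hy.
    exact (Hd y Hy Sy).
  - intros H; split; [apply (is_linear_scal_l (K := R_AbsRing) l)|].
    intros x' Hx'.
    assert (PF : ProperFilter' (within S (locally x))).
    { split; [|apply within_filter, locally_filter].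
      intros [d Hd]; exact (Hd x (ball_center x d) Sx). }
    assert (E : x = x').
    { apply (is_filter_lim_unique (FF := PF)); [apply filter_le_within|exact Hx']. }
    subst x'; intros eps; destruct (H eps) as [d Hd].
    exists d; intros y Hy Sy; exact (Hd y Sy Hy).
Qed.

(** The condition under which relative derivatives are unique, so that the [iota] in [derive_on]
    returns the intended value. *)
Definition limit_point (S : R -> Prop) (x : R) : Prop :=
  S x /\ forall d : posreal, exists y, S y /\ y <> x /\ Rabs (y - x) < d.

Lemma limit_point_Icc (a b x : R) : a < b -> a <= x <= b -> limit_point (Icc a b) x.
Proof.
  intros Hab Hx; split; [exact Hx|]; intros [d Hd]; simpl.
  destruct (Rlt_le_dec x b).
  - exists (x + Rmin (d / 2) (b - x)).
    assert (0 < Rmin (d / 2) (b - x) /\ Rmin (d / 2) (b - x) < d /\ Rmin (d / 2) (b - x) <= b - x)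
      by (unfold Rmin; destruct Rle_dec; lra).
    split; [unfold Icc; lra|split; [lra|]].
    apply Rabs_def1; lra.
  - exists (x - Rmin (d / 2) (x - a)).
    assert (0 < Rmin (d / 2) (x - a) /\ Rmin (d / 2) (x - a) < d /\ Rmin (d / 2) (x - a) <= x - a)
      by (unfold Rmin; destruct Rle_dec; lra).
    split; [unfold Icc; lra|split; [lra|]].
    apply Rabs_def1; lra.
Qed.

Lemma limit_point_nonneg_time (t : R) : 0 <= t -> limit_point nonneg_time t.
Proof.
  intros Ht; split; [exact Ht|]; intros [d Hd]; simpl; exists (t + d / 2).
  unfold nonneg_time; split; [lra|split; [lra|]]; apply Rabs_def1; lra.
Qed.

Lemma is_derive_on_unique (S : R -> Prop) (f : R -> R) (x l1 l2 : R) :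
  limit_point S x -> is_derive_on S f x l1 -> is_derive_on S f x l2 -> l1 = l2.
Proof.
  intros [Sx HS] H1 H2; generalize (proj1 (is_derive_on_spec S f x l1 Sx) H1); clear H1; intros H1; generalize (proj1 (is_derive_on_spec S f x l2 Sx) H2); clear H2; intros H2.
  apply cond_eq; intros eps He.
  assert (He4 : 0 < eps / 4) by lra.
  destruct (H1 (mkposreal _ He4)) as [d1 K1]; destruct (H2 (mkposreal _ He4)) as [d2 K2].
  destruct (HS (mkposreal _ (Rmin_stable_in_posreal d1 d2))) as [y [Sy [Hne Hy]]]; simpl in Hy.
  assert (Hy1 : Rabs (y - x) < d1) by (apply Rlt_le_trans with (1 := Hy), Rmin_l).
  assert (Hy2 : Rabs (y - x) < d2) by (apply Rlt_le_trans with (1 := Hy), Rmin_r).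
  specialize (K1 y Sy Hy1); specialize (K2 y Sy Hy2); simpl in K1, K2.
  assert (Hp : 0 < Rabs (y - x)) by (apply Rabs_pos_lt; lra).
  apply Rmult_lt_reg_r with (Rabs (y - x)); trivial.
  rewrite <- Rabs_mult.
  replace ((l1 - l2) * (y - x)) with
    ((f y - f x - (y - x) * l2) - (f y - f x - (y - x) * l1)) by ring.
  eapply Rle_lt_trans; [apply Rabs_triang|]; rewrite Rabs_Ropp; nra.
Qed.

Lemma derive_on_unique (S : R -> Prop) (f : R -> R) (x l : R) :
  limit_point S x -> is_derive_on S f x l -> derive_on S f x = l.
Proof.
  intros HS H; apply (iota_unique (V := R_CompleteNormedModule)); trivial.
  intros l' H'; apply (is_derive_on_unique S f x); trivial.
Qed.

Lemma is_derive_is_derive_on (S : R -> Prop) (f : R -> R) (x l : R) :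
  S x -> is_derive f x l -> is_derive_on S f x l.
Proof.
  intros Sx [_ H]; apply is_derive_on_spec; trivial; intros eps.
  assert (Hx : is_filter_lim (locally x) x) by (intros P HP; exact HP).
  destruct (H x Hx eps) as [d Hd]; exists d; intros y _ Hy; exact (Hd y Hy).
Qed.

Lemma is_derive_on_ext (S : R -> Prop) (f h : R -> R) (x l : R) :
  S x -> (forall y, S y -> f y = h y) -> is_derive_on S f x l -> is_derive_on S h x l.
Proof.
  intros Sx E H; generalize (proj1 (is_derive_on_spec S f x l Sx) H); clear H; intros H; apply is_derive_on_spec; trivial.
  intros eps; destruct (H eps) as [d Hd]; exists d; intros y Sy Hy.
  rewrite <- !E by trivial; apply Hd; trivial.
Qed.

(** A relative derivative [l] at a point gives a local Lipschitz estimate there with constant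
    [Rabs l + 1], and [clamp] is 1-Lipschitz. This turns one-sided smoothness of the density into
    continuity on the whole line. *)
Lemma continuous_clamp_of_ex_derive_on (a b : R) (f : R -> R) (x : R) :
  a <= b -> (forall y, a <= y <= b -> ex_derive_on (Icc a b) f y) ->
  continuous (fun y => f (clamp a b y)) x.
Proof.
  intros Hab Hf; apply filterlim_locally; intros eps.
  set (c := clamp a b x).
  assert (Hc : a <= c <= b) by (apply clamp_in; trivial).
  destruct (Hf c Hc) as [l Hl]; generalize (proj1 (is_derive_on_spec (Icc a b) f c l Hc) Hl); clear Hl; intros Hl.
  destruct (Hl (mkposreal 1 Rlt_0_1)) as [d Hd]; simpl in Hd.
  set (m := Rabs l + 1).
  assert (Hm : 0 < m) by (pose proof (Rabs_pos l); unfold m; lra).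
  assert (Hem : 0 < eps / m) by (apply Rdiv_lt_0_compat; [apply eps|trivial]).
  exists (mkposreal _ (Rmin_stable_in_posreal d (mkposreal _ Hem))); intros y Hy.
  change (Rabs (y - x) < Rmin d (eps / m)) in Hy.
  change (Rabs (f (clamp a b y) - f c) < eps).
  pose proof (clamp_lipschitz a b x y Hab) as HL; fold c in HL.
  set (e := clamp a b y) in *.
  assert (He : a <= e <= b) by (apply clamp_in; trivial).
  assert (Hed : Rabs (e - c) < d).
  { apply Rle_lt_trans with (1 := HL), Rlt_le_trans with (1 := Hy), Rmin_l. }
  assert (Hee : Rabs (e - c) < eps / m).
  { apply Rle_lt_trans with (1 := HL), Rlt_le_trans with (1 := Hy), Rmin_r. }
  specialize (Hd e He Hed).
  replace (f e - f c) with ((f e - f c - (e - c) * l) + (e - c) * l) by ring.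
  eapply Rle_lt_trans; [apply Rabs_triang|]; rewrite Rabs_mult.
  apply Rle_lt_trans with (Rabs (e - c) * m); [unfold m; lra|].
  apply Rmult_lt_reg_r with (/ m); [apply Rinv_0_lt_compat; trivial|].
  rewrite Rmult_assoc, Rinv_r, Rmult_1_r by lra; exact Hee.
Qed.

(** Agreement is asked only on the physical domain: there the total operators [dt], [dr], [dth] send
    modes to modes, whatever values they take elsewhere. *)
Definition is_mode (R1 R2 l : R) (a h : R -> R) (f : field) : Prop :=
  forall t r th, 0 <= t -> R1 <= r <= R2 -> f t r th = exp (l * t) * (a r * h th).

Lemma is_mode_is_derive_t (R1 R2 l : R) (a h : R -> R) (f : field) (t r th : R) :
  is_mode R1 R2 l a h f -> 0 <= t -> R1 <= r <= R2 ->
  is_derive_on nonneg_time (fun s => f s r th) t (exp (l * t) * (l * a r * h th)).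
Proof.
  intros H Ht Hr.
  apply (is_derive_on_ext _ (fun s => exp (l * s) * (a r * h th))); [exact Ht| |].
  - intros s Hs; symmetry; apply H; trivial.
  - apply is_derive_is_derive_on; [exact Ht|]; auto_derive; trivial; ring.
Qed.

Lemma is_mode_is_derive_r (R1 R2 l : R) (a h : R -> R) (f : field) (t r th d : R) :
  is_mode R1 R2 l a h f -> 0 <= t -> R1 <= r <= R2 -> is_derive a r d ->
  is_derive_on (Icc R1 R2) (fun x => f t x th) r (exp (l * t) * (d * h th)).
Proof.
  intros H Ht Hr Hd.
  apply (is_derive_on_ext _ (fun x => exp (l * t) * (a x * h th))); [exact Hr| |].
  - intros s Hs; symmetry; apply H; trivial.
  - apply is_derive_is_derive_on; [exact Hr|].
    auto_derive; [eexists; eassumption|].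
    rewrite (is_derive_unique (fun x : R => a x) r d Hd); ring.
Qed.

Lemma is_mode_is_derive_th (R1 R2 l : R) (a h : R -> R) (f : field) (t r th d : R) :
  is_mode R1 R2 l a h f -> 0 <= t -> R1 <= r <= R2 -> is_derive h th d ->
  is_derive (fun x => f t r x) th (exp (l * t) * (a r * d)).
Proof.
  intros H Ht Hr Hd.
  apply (is_derive_ext (fun x => exp (l * t) * (a r * h x))).
  - intros s; symmetry; apply H; trivial.
  - auto_derive; [eexists; eassumption|].
    rewrite (is_derive_unique (fun x : R => h x) th d Hd); ring.
Qed.

Lemma is_mode_dt (R1 R2 l : R) (a h : R -> R) (f : field) :
  is_mode R1 R2 l a h f -> is_mode R1 R2 l (fun r => l * a r) h (dt f).
Proof.
  intros H t r th Ht Hr; unfold dt; apply derive_on_unique.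
  - apply limit_point_nonneg_time; trivial.
  - apply (is_mode_is_derive_t R1 R2); trivial.
Qed.

Lemma is_mode_dr (R1 R2 l : R) (a a' h : R -> R) (f : field) :
  R1 < R2 -> is_mode R1 R2 l a h f ->
  (forall r, R1 <= r <= R2 -> is_derive a r (a' r)) ->
  is_mode R1 R2 l a' h (dr R1 R2 f).
Proof.
  intros h12 H Ha t r th Ht Hr; unfold dr; apply derive_on_unique.
  - apply limit_point_Icc; trivial.
  - apply (is_mode_is_derive_r R1 R2 l a); auto.
Qed.

Lemma is_mode_dth (R1 R2 l : R) (a h h' : R -> R) (f : field) :
  is_mode R1 R2 l a h f -> (forall th, is_derive h th (h' th)) ->
  is_mode R1 R2 l a h' (dth f).
Proof.
  intros H Hh t r th Ht Hr; unfold dth; apply is_derive_unique.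
  apply (is_mode_is_derive_th R1 R2 l a h); auto.
Qed.

Lemma is_mode_continuous_field (R1 R2 l : R) (a h : R -> R) (f : field) :
  is_mode R1 R2 l a h f ->
  (forall r, R1 <= r <= R2 -> continuous a r) -> (forall th, continuous h th) ->
  continuous_field R1 R2 f.
Proof.
  intros H Ha Hh; unfold continuous_field.
  eapply continuous_on_ext.
  { intros q [Ht Hr]; symmetry; apply H; [exact Ht|exact Hr]. }
  intros [[t r] th] [Ht Hr]; simpl in Ht, Hr.
  apply (filterlim_filter_le_1 (G := within _ (locally (t, r, th))) (F := locally (t, r, th)));
    [apply filter_le_within|].
  change (continuous (fun q : R * R * R => exp (l * fst (fst q)) * (a (snd (fst q)) * h (snd q))) (t, r, th)).
  assert (C1 : continuous (fun q : R * R * R => fst (fst q)) (t, r, th)).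
  { apply (continuous_comp fst fst); apply continuous_fst. }
  assert (C2 : continuous (fun q : R * R * R => snd (fst q)) (t, r, th)).
  { apply (continuous_comp fst snd); [apply continuous_fst|apply continuous_snd]. }
  assert (C3 : continuous (fun q : R * R * R => snd q) (t, r, th)) by apply continuous_snd.
  apply (continuous_mult (K := R_AbsRing) (fun q : R * R * R => exp (l * fst (fst q)))
    (fun q : R * R * R => a (snd (fst q)) * h (snd q))).
  - apply (continuous_comp (fun q : R * R * R => fst (fst q)) (fun s => exp (l * s))); [exact C1|].
    apply (is_derive_continuous (fun s => exp (l * s)) _ (l * exp (l * t))).
    simpl; auto_derive; trivial; ring.
  - apply (continuous_mult (K := R_AbsRing) (fun q : R * R * R => a (snd (fst q)))
      (fun q : R * R * R => h (snd q))).
    + apply (continuous_comp (fun q : R * R * R => snd (fst q)) a); [exact C2|apply Ha; exact Hr].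
    + apply (continuous_comp (fun q : R * R * R => snd q) h); [exact C3|apply Hh].
Qed.

Lemma is_mode_C1_time (R1 R2 l : R) (a h : R -> R) (f : field) :
  is_mode R1 R2 l a h f ->
  (forall r, R1 <= r <= R2 -> continuous a r) -> (forall th, continuous h th) ->
  C1_time R1 R2 f.
Proof.
  intros H Ha Hh; split; [|split].
  - intros t r th Ht Hr; eexists; apply (is_mode_is_derive_t R1 R2 l a h); trivial.
  - apply (is_mode_continuous_field R1 R2 l a h); trivial.
  - apply (is_mode_continuous_field R1 R2 l (fun r => l * a r) h); trivial.
    + apply is_mode_dt; trivial.
    + intros r Hr; pose proof (Ha r Hr); cont.
Qed.

Lemma is_mode_C1_space (R1 R2 l : R) (a a' h h' : R -> R) (f : field) :
  R1 < R2 -> is_mode R1 R2 l a h f ->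
  (forall r, R1 <= r <= R2 -> is_derive a r (a' r)) ->
  (forall r, R1 <= r <= R2 -> continuous a' r) ->
  (forall th, is_derive h th (h' th)) -> (forall th, continuous h' th) ->
  C1_space R1 R2 f.
Proof.
  intros h12 H Ha Ca Hh Ch.
  assert (Ca0 : forall r, R1 <= r <= R2 -> continuous a r).
  { intros r Hr; eapply is_derive_continuous; apply Ha; trivial. }
  assert (Ch0 : forall th, continuous h th).
  { intros th; eapply is_derive_continuous; apply Hh. }
  split; [|split; [|split]].
  - intros t r th Ht Hr; split; eexists.
    + apply (is_mode_is_derive_r R1 R2 l a h); auto.
    + apply (is_mode_is_derive_th R1 R2 l a h); auto.
  - apply (is_mode_continuous_field R1 R2 l a h); trivial.
  - apply (is_mode_continuous_field R1 R2 l a' h); trivial.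
    apply (is_mode_dr R1 R2 l a); trivial.
  - apply (is_mode_continuous_field R1 R2 l a h'); trivial.
    apply (is_mode_dth R1 R2 l a h); trivial.
Qed.

Lemma is_mode_C2_space (R1 R2 l : R) (a a' a'' h h' h'' : R -> R) (f : field) :
  R1 < R2 -> is_mode R1 R2 l a h f ->
  (forall r, R1 <= r <= R2 -> is_derive a r (a' r)) ->
  (forall r, R1 <= r <= R2 -> is_derive a' r (a'' r)) ->
  (forall r, R1 <= r <= R2 -> continuous a'' r) ->
  (forall th, is_derive h th (h' th)) -> (forall th, is_derive h' th (h'' th)) ->
  (forall th, continuous h'' th) ->
  C2_space R1 R2 f.
Proof.
  intros h12 H Ha Ha' Ca Hh Hh' Ch.
  assert (Ca0 : forall r, R1 <= r <= R2 -> continuous a' r).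
  { intros r Hr; eapply is_derive_continuous; apply Ha'; trivial. }
  assert (Ch0 : forall th, continuous h' th).
  { intros th; eapply is_derive_continuous; apply Hh'. }
  split; [|split].
  - apply (is_mode_C1_space R1 R2 l a a' h h'); trivial.
  - apply (is_mode_C1_space R1 R2 l a' a'' h h'); trivial.
    apply (is_mode_dr R1 R2 l a); trivial.
  - apply (is_mode_C1_space R1 R2 l a a' h' h''); trivial.
    apply (is_mode_dth R1 R2 l a h); trivial.
Qed.

Lemma is_mode_periodic (R1 R2 l : R) (a h : R -> R) (f : field) :
  is_mode R1 R2 l a h f -> (forall th, h (th + 2 * PI) = h th) ->
  periodic_field R1 R2 f.
Proof. intros H Hh t r th Ht Hr; rewrite !H by trivial; rewrite Hh; reflexivity. Qed.

(** * From the radial mode to the linearized system *)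

(** The pressure is not part of the initial value, so a mode carried by [q] alone must be excluded.
    If [u] and [W] vanish, so does [Z = W'], and the azimuthal equation then forces [q] to
    vanish. *)
Lemma mode_nontrivial (R1 R2 mu l : R) (rho G u W Z q : R -> R) :
  0 < R1 -> R1 < R2 -> 0 < mu ->
  mode_ode R1 R2 mu l rho G (fun _ => 0) u W Z q -> Z R2 <> 0 \/ q R2 <> 0 ->
  exists r, R1 <= r <= R2 /\ (u r <> 0 \/ W r <> 0).
Proof.
  intros h1 h12 hmu H Hne; apply NNPP; intros Hno.
  assert (H0 : forall r, R1 <= r <= R2 -> u r = 0 /\ W r = 0).
  { intros r Hr; split; apply NNPP; intros Hr0; apply Hno; exists r; auto. }
  assert (Hd : forall f d, (forall r, R1 <= r <= R2 -> f r = 0) ->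
    (forall r, R1 <= r <= R2 -> is_derive f r (d r)) -> forall r, R1 <= r <= R2 -> d r = 0).
  { intros f d Hf Hfd r Hr.
    apply (is_derive_on_unique (Icc R1 R2) f r); [apply limit_point_Icc; trivial| |].
    - apply is_derive_is_derive_on; auto.
    - apply (is_derive_on_ext _ (fun _ => 0)); [exact Hr| |].
      + intros y Hy; symmetry; apply Hf; exact Hy.
      + apply is_derive_is_derive_on; [exact Hr|apply (is_derive_const (V := R_NormedModule))]. }
  assert (HZ : forall r, R1 <= r <= R2 -> Z r = 0).
  { apply (Hd W); [apply H0|]; intros r Hr; apply (H r Hr). }
  assert (Hq : forall r, R1 <= r <= R2 -> l * rho r * W r / mu - Z r / r
                      + 2 * (u r + W r) / r ^ 2 - q r / (mu * r) = 0).
  { apply (Hd Z); [exact HZ|]; intros r Hr; apply (H r Hr). }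
  specialize (Hq R2 ltac:(lra)); destruct (H0 R2 ltac:(lra)) as [E1 E2].
  rewrite (HZ R2 ltac:(lra)), E1, E2 in Hq.
  destruct Hne as [Hne|Hne]; [apply Hne, HZ; lra|apply Hne].
  replace (q R2) with (- (mu * R2) * (l * rho R2 * 0 / mu - 0 / R2 + 2 * (0 + 0) / R2 ^ 2 - q R2 / (mu * R2)))
    by (field; lra).
  rewrite Hq; ring.
Qed.

Lemma cos_2PI_add (th : R) : cos (th + 2 * PI) = cos th.
Proof. rewrite cos_plus, cos_2PI, sin_2PI; ring. Qed.

Lemma sin_2PI_add (th : R) : sin (th + 2 * PI) = sin th.
Proof. rewrite sin_plus, cos_2PI, sin_2PI; ring. Qed.

(** Undoes the elimination of the density: as [G = g * rhobar'], the amplitude [- (u * G) / (l * g)]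
    is [- u * rhobar' / l], which the mass equation dictates. *)
Lemma mode_linearized_solution (R1 R2 mu g alpha l : R) (rhobar rho G u W Z q : R -> R) :
  0 < R1 -> R1 < R2 -> 0 < mu -> 0 < g -> 0 < l ->
  (forall x, continuous rho x) -> (forall x, continuous G x) ->
  (forall x, R1 <= x <= R2 -> rho x = rhobar x) ->
  (forall x, R1 <= x <= R2 -> G x = g * derive_on (Icc R1 R2) rhobar x) ->
  mode_ode R1 R2 mu l rho G (fun _ => 0) u W Z q ->
  mode_bc R1 R2 (1 / R1 - alpha / mu) u W Z ->
  linearized_solution R1 R2 mu g alpha rhobar
    (exp_mode l (fun r th => u r * cos th)) (exp_mode l (fun r th => W r * sin th))
    (exp_mode l (fun r th => - (u r * G r) / (l * g) * cos th))
    (exp_mode l (fun r th => q r * cos th)).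
Proof.
  intros h1 h12 hmu hg hl hrho hG Erho EG H [Eu1 [Eu2 [EW2 EZ1]]].
  set (vr := exp_mode l (fun r th => u r * cos th)).
  set (vth := exp_mode l (fun r th => W r * sin th)).
  set (rh := exp_mode l _).
  set (p := exp_mode l (fun r th => q r * cos th)).
  assert (Mvr : is_mode R1 R2 l u cos vr) by (intros t r th _ _; reflexivity).
  assert (Mvth : is_mode R1 R2 l W sin vth) by (intros t r th _ _; reflexivity).
  assert (Mrh : is_mode R1 R2 l (fun r => - (u r * G r) / (l * g)) cos rh) by (intros t r th _ _; reflexivity).
  assert (Mp : is_mode R1 R2 l q cos p) by (intros t r th _ _; reflexivity).
  set (u1 := fun x => - (u x + W x) / x).
  (* The second radial derivative of [u], absent from the first-order system, comes from
     differentiating the incompressibility relation [u' = - (u + W) / x]. *)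
  set (u2 := fun x => 2 * (u x + W x) / x ^ 2 - Z x / x).
  set (W2 := fun x => l * rho x * W x / mu - Z x / x + 2 * (u x + W x) / x ^ 2 - q x / (mu * x)).
  set (q1 := fun x => - mu * (Z x / x + (u x + W x) / x ^ 2) - l * rho x * u x + G x * u x / l + 0).
  assert (Du : forall x, R1 <= x <= R2 -> is_derive u x (u1 x)) by (intros x Hx; apply (H x Hx)).
  assert (DW : forall x, R1 <= x <= R2 -> is_derive W x (Z x)) by (intros x Hx; apply (H x Hx)).
  assert (DZ : forall x, R1 <= x <= R2 -> is_derive Z x (W2 x)) by (intros x Hx; apply (H x Hx)).
  assert (Dq : forall x, R1 <= x <= R2 -> is_derive q x (q1 x)) by (intros x Hx; apply (H x Hx)).
  assert (Du1 : forall x, R1 <= x <= R2 -> is_derive u1 x (u2 x)).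
  { intros x Hx; pose proof (Du x Hx); pose proof (DW x Hx); unfold u1; auto_derive.
    - repeat split; try lra; eexists; eassumption.
    - erewrite !(is_derive_unique (fun x : R => u x)), !(is_derive_unique (fun x : R => W x)) by eassumption.
      unfold u1, u2; field; lra. }
  assert (C : forall x, R1 <= x <= R2 -> continuous u x /\ continuous W x /\ continuous Z x /\ continuous q x).
  { intros x Hx; repeat split; eapply is_derive_continuous; auto. }
  assert (Cu2 : forall x, R1 <= x <= R2 -> continuous u2 x).
  { intros x Hx; destruct (C x Hx) as [? [? [? ?]]]; unfold u2; cont; try lra; apply pow_nonzero; lra. }
  assert (CW2 : forall x, R1 <= x <= R2 -> continuous W2 x).
  { intros x Hx; destruct (C x Hx) as [? [? [? ?]]]; unfold W2; cont; try lra; try (apply pow_nonzero; lra).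
    apply Rmult_integral_contrapositive_currified; lra. }
  assert (Cq1 : forall x, R1 <= x <= R2 -> continuous q1 x).
  { intros x Hx; destruct (C x Hx) as [? [? [? ?]]]; unfold q1; cont; try lra; apply pow_nonzero; lra. }
  assert (Crh : forall x, R1 <= x <= R2 -> continuous (fun r => - (u r * G r) / (l * g)) x).
  { intros x Hx; destruct (C x Hx) as [? [? [? ?]]]; cont.
    apply Rmult_integral_contrapositive_currified; lra. }
  assert (Dcos : forall th, is_derive cos th (- sin th)) by (intros; auto_derive; trivial; ring).
  assert (Dsin : forall th, is_derive sin th (cos th)) by (intros; auto_derive; trivial; ring).
  assert (Dmsin : forall th, is_derive (fun x => - sin x) th (- cos th)) by (intros; auto_derive; trivial; ring).
  assert (Ccos : forall th, continuous cos th) by (intros th; exact (is_derive_continuous _ _ _ (Dcos th))).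
  assert (Csin : forall th, continuous sin th) by (intros th; exact (is_derive_continuous _ _ _ (Dsin th))).
  assert (Cmcos : forall th, continuous (fun x => - cos x) th) by (intros th; cont).
  assert (Cmsin : forall th, continuous (fun x => - sin x) th) by (intros th; cont).
  assert (Mvr_r := is_mode_dr _ _ _ _ _ _ _ h12 Mvr Du).
  assert (Mvr_rr := is_mode_dr _ _ _ _ _ _ _ h12 Mvr_r Du1).
  assert (Mvr_th := is_mode_dth _ _ _ _ _ _ _ Mvr Dcos).
  assert (Mvr_thth := is_mode_dth _ _ _ _ _ _ _ Mvr_th Dmsin).
  assert (Mvth_r := is_mode_dr _ _ _ _ _ _ _ h12 Mvth DW).
  assert (Mvth_rr := is_mode_dr _ _ _ _ _ _ _ h12 Mvth_r DZ).
  assert (Mvth_th := is_mode_dth _ _ _ _ _ _ _ Mvth Dsin).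
  assert (Mvth_thth := is_mode_dth _ _ _ _ _ _ _ Mvth_th Dcos).
  assert (Mp_r := is_mode_dr _ _ _ _ _ _ _ h12 Mp Dq).
  assert (Mp_th := is_mode_dth _ _ _ _ _ _ _ Mp Dcos).
  assert (Mvr_t := is_mode_dt _ _ _ _ _ _ Mvr).
  assert (Mvth_t := is_mode_dt _ _ _ _ _ _ Mvth).
  assert (Mrh_t := is_mode_dt _ _ _ _ _ _ Mrh).
  split.
  - apply (is_mode_periodic R1 R2 l u cos); trivial; exact cos_2PI_add.
  - apply (is_mode_periodic R1 R2 l W sin); trivial; exact sin_2PI_add.
  - apply (is_mode_periodic R1 R2 l (fun r => - (u r * G r) / (l * g)) cos); trivial; exact cos_2PI_add.
  - apply (is_mode_periodic R1 R2 l q cos); trivial; exact cos_2PI_add.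
  - split.
    + apply (is_mode_C1_time R1 R2 l u cos); trivial; apply C.
    + apply (is_mode_C2_space R1 R2 l u u1 u2 cos (fun th => - sin th) (fun th => - cos th)); trivial.
  - split.
    + apply (is_mode_C1_time R1 R2 l W sin); trivial; apply C.
    + apply (is_mode_C2_space R1 R2 l W Z W2 sin cos (fun th => - sin th)); trivial.
  - apply (is_mode_C1_time R1 R2 l (fun r => - (u r * G r) / (l * g)) cos); trivial.
  - apply (is_mode_C1_space R1 R2 l q q1 cos (fun th => - sin th)); trivial.
  - intros t r th Ht Hr; unfold laplace_r.
    rewrite Mvr_t, Mvr_rr, Mvr_r, Mvr_thth, Mvth_th, Mp_r, Mvr, Mrh, <- Erho by trivial.
    unfold u1, u2, q1; field; lra.
  - intros t r th Ht Hr; unfold laplace_r.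
    rewrite Mvth_t, Mvth_rr, Mvth_r, Mvth_thth, Mvr_th, Mp_th, Mvth, <- Erho by trivial.
    unfold W2; field; lra.
  - intros t r th Ht Hr.
    rewrite Mrh_t, Mvr, EG by trivial; field; lra.
  - intros t r th Ht Hr.
    assert (Mrv : is_mode R1 R2 l (fun r => r * u r) cos (fun t r th => r * vr t r th)).
    { intros t' r' th' Ht' Hr'; rewrite Mvr by trivial; ring. }
    assert (Dru : forall x, R1 <= x <= R2 -> is_derive (fun r => r * u r) x (u x + x * u1 x)).
    { intros x Hx; pose proof (Du x Hx); auto_derive; [eexists; eassumption|].
      erewrite (is_derive_unique (fun x : R => u x)) by eassumption; ring. }
    rewrite (is_mode_dr _ _ _ _ _ _ _ h12 Mrv Dru), Mvth_th by trivial.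
    unfold u1; field; lra.
  - intros t th Ht; rewrite Mvr, Eu1 by lra; ring.
  - intros t th Ht; rewrite Mvr, Eu2 by lra; ring.
  - intros t th Ht; rewrite Mvth, EW2 by lra; ring.
  - intros t th Ht; rewrite Mvth_r, Mvth, EZ1 by lra; ring.
Qed.

Theorem theorem1p5 (R1 R2 mu g alpha : R) (rhobar pbar : R -> R)
    (hR1 : 0 < R1) (hR12 : R1 < R2) (hmu : 0 < mu) (hg : 0 < g)
    (halpha : 1 - alpha * R1 / mu >= 0)
    (hsmooth : smooth_on (Icc R1 R2) rhobar)
    (hpos : forall r, R1 <= r <= R2 -> 0 < rhobar r)
    (hsteady : steady_state R1 R2 g rhobar pbar)
    (hunstable : exists rs, R1 < rs < R2 /\ derive_on (Icc R1 R2) rhobar rs > 0) :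
  exists (v0r v0th rho0 : R -> R -> R) (lambda : R),
    (exists r th, R1 <= r <= R2 /\
       (v0r r th <> 0 \/ v0th r th <> 0 \/ rho0 r th <> 0))
    /\ lambda > 0
    /\ (exists p : field,
          linearized_solution R1 R2 mu g alpha rhobar
            (exp_mode lambda v0r) (exp_mode lambda v0th)
            (exp_mode lambda rho0) p)
    /\ has_initial_value R1 R2 (exp_mode lambda v0r) v0r
    /\ has_initial_value R1 R2 (exp_mode lambda v0th) v0th
    /\ has_initial_value R1 R2 (exp_mode lambda rho0) rho0.
Proof.
  destruct hunstable as [rs [hrs hD]].
  set (rho := fun x => rhobar (clamp R1 R2 x)).
  set (G := fun x => g * derive_on (Icc R1 R2) rhobar (clamp R1 R2 x)).
  assert (hrho : forall x, continuous rho x).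
  { intros x; apply continuous_clamp_of_ex_derive_on; [lra|]; intros y Hy; exact (hsmooth 0%nat y Hy). }
  assert (hG : forall x, continuous G x).
  { intros x; unfold G; apply continuous_multR; [apply continuous_const|].
    apply (continuous_clamp_of_ex_derive_on R1 R2 (derive_on (Icc R1 R2) rhobar)); [lra|].
    intros y Hy; exact (hsmooth 1%nat y Hy). }
  assert (Erho : forall x, R1 <= x <= R2 -> rho x = rhobar x).
  { intros x Hx; unfold rho; rewrite clamp_id; trivial. }
  assert (EG : forall x, R1 <= x <= R2 -> G x = g * derive_on (Icc R1 R2) rhobar x).
  { intros x Hx; unfold G; rewrite clamp_id; trivial. }
  (* The minimum over the compact interval turns pointwise positivity of the density into the
     uniform lower bound [m0]. *)
  destruct (continuity_ab_min rho R1 R2 (Rlt_le _ _ hR12)) as [xm [Hmin Hxm]].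
  { intros x _; apply continuity_pt_filterlim, hrho. }
  set (kappa := 1 / R1 - alpha / mu).
  assert (hkappa : 0 <= kappa).
  { apply Rmult_le_reg_l with R1; [trivial|].
    replace (R1 * kappa) with (1 - alpha * R1 / mu) by (unfold kappa; field; lra); lra. }
  destruct (exists_pair_formB_pos R1 R2 rs G) as [v [w [z [Hv HB]]]]; trivial.
  { rewrite EG by lra; apply Rmult_lt_0_compat; trivial. }
  destruct (exists_nontrivial_mode R1 R2 mu kappa (rho xm) rho G v w z)
    as [l [u [W [Z [q [Hl [Hode [Hbc Hne]]]]]]]]; trivial.
  { rewrite Erho by trivial; apply hpos; trivial. }
  exists (fun r th => u r * cos th), (fun r th => W r * sin th),
    (fun r th => - (u r * G r) / (l * g) * cos th), l.
  assert (Hinit : forall f0, has_initial_value R1 R2 (exp_mode l f0) f0).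
  { intros f0 r th _; unfold exp_mode; rewrite Rmult_0_r, exp_0; ring. }
  split; [|split; [exact Hl|split; [|auto]]].
  - destruct (mode_nontrivial R1 R2 mu l rho G u W Z q) as [r [Hr [Hu|HW]]]; trivial.
    (* The angle is chosen where the angular factor of the nonzero component equals 1: 0 for the
       cosine, [PI / 2] for the sine. *)
    + exists r, 0; split; trivial; left; rewrite cos_0; lra.
    + exists r, (PI / 2); split; trivial; right; left; rewrite sin_PI2; lra.
  - exists (exp_mode l (fun r th => q r * cos th)).
    apply (mode_linearized_solution R1 R2 mu g alpha l rhobar rho G u W Z q); trivial.
Qed.
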